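(* Let $\psi$ be analytic and univalent in $\Delta$ with $\psi(0)=0$ and $\psi(\Delta)$ starlike with respect to $0$. Suppose that for every $r\in(0,1)$ $$\max_{|z|=r}|\psi(z)|=\psi(r),\qquad \max_{|z|=r}\Re\psi(z)=\psi(r),\qquad \min_{|z|=r}\Re\psi(z)=\psi(-r).$$ Let $M(r)=\exp\left(\int_0^r\frac{\psi(t)}{t}\,dt\right)$. If $f\in\mathcal{F}(\psi)$, then for $|z|=r$, $0<r<1$, $$\Re\frac{f(z)}{z}\le M(r),\qquad |f'(z)|\le(1+\psi(r))M(r),\qquad L(f,r)\le 2\pi r(1+\psi(r))M(r).$$
   Context: $\Delta=\{z\in\mathbb{C}:|z|<1\}$. $\mathcal{A}$ is the class of analytic functions $f(z)=z+\sum_{k\ge2}a_kz^k$ in $\Delta$. For analytic $g,h$ on $\Delta$, $g\prec h$ (subordination) means $g=h\circ\omega$ for some analytic $\omega:\Delta\to\Delta$ with $\omega(0)=0$. $\mathcal{F}(\psi)$ is the class of $f\in\mathcal{A}$ with $\frac{zf'(z)}{f(z)}-1\prec\psi(z)$ in $\Delta$ (in particular $zf'(z)/f(z)$ is analytic in $\Delta$). $L(f,r)=\int_0^{2\pi}|zf'(z)|\,d\theta$ with $z=re^{i\theta}$ is the length of the curve $f(|z|=r)$. *)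

(* Defs.v *)
From Stdlib Require Import Reals.
From Coquelicot Require Import Coquelicot.
Open Scope R_scope.

Definition disc (z : C) : Prop := Cmod z < 1.

(* The field is made explicit: this is complex differentiability. *)
Definition analytic_disc (f : C -> C) : Prop :=
  forall z : C, disc z -> ex_derive (K := C_AbsRing) (V := C_NormedModule) f z.

Definition univalent_disc (f : C -> C) : Prop :=
  analytic_disc f /\
  forall z w : C, disc z -> disc w -> f z = f w -> z = w.

Definition image_disc (f : C -> C) (w : C) : Prop :=
  exists z : C, disc z /\ f z = w.

Definition starlike_wrt (c : C) (D : C -> Prop) : Prop :=
  D c /\
  forall (w : C) (t : R), D w -> 0 <= t <= 1 ->
    D (RtoC (1 - t) * c + RtoC t * w)%C.

Definition class_A (f : C -> C) : Prop :=
  analytic_disc f /\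
  exists a : nat -> C,
    a 0%nat = RtoC 0 /\ a 1%nat = RtoC 1 /\
    forall z : C, disc z ->
      is_pseries (K := C_AbsRing) (V := C_NormedModule) a z (f z).

Definition subordinate (g h : C -> C) : Prop :=
  analytic_disc g /\ analytic_disc h /\
  exists omega : C -> C,
    analytic_disc omega /\
    (forall z : C, disc z -> disc (omega z)) /\
    omega (RtoC 0) = RtoC 0 /\
    forall z : C, disc z -> g z = h (omega z).

(* z f'(z) / f(z), with the removable singularity at 0 filled in by its limit
   1 for f in class_A. *)
Definition log_derivative (f : C -> C) (z : C) : C :=
  if Ceq_dec z (RtoC 0) then RtoC 1 else (z * C_derive f z / f z)%C.

(* A zero of f off the origin would be a pole of z f'(z) / f(z); as division is
   total here, its absence is stated explicitly. *)
Definition class_F (psi f : C -> C) : Prop :=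
  class_A f /\
  (forall z : C, disc z -> z <> RtoC 0 -> f z <> RtoC 0) /\
  subordinate (fun z => log_derivative f z - RtoC 1)%C psi.

(* The value v is complex: being the maximum (minimum) of a real-valued
   function includes being real. *)
Definition is_circle_max (h : C -> R) (r : R) (v : C) : Prop :=
  exists m : R, v = RtoC m /\
    (exists z : C, Cmod z = r /\ h z = m) /\
    forall z : C, Cmod z = r -> h z <= m.

Definition is_circle_min (h : C -> R) (r : R) (v : C) : Prop :=
  exists m : R, v = RtoC m /\
    (exists z : C, Cmod z = r /\ h z = m) /\
    forall z : C, Cmod z = r -> m <= h z.

(* Used for psi real on (0,1), where Re (psi t) is psi t itself. *)
Definition M (psi : C -> C) (r : R) : R :=
  exp (RInt (fun t : R => Re (psi (RtoC t)) / t) 0 r).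

Definition curve_length (f : C -> C) (r : R) : R :=
  RInt (fun theta : R =>
          let z : C := (r * cos theta, r * sin theta) in
          Cmod (z * C_derive f z)%C)
       0 (2 * PI).

(* Main.v *)
Require Import Defs.
From Stdlib Require Import Reals Ranalysis5 Lra ClassicalEpsilon.
From Coquelicot Require Import Coquelicot.
Open Scope R_scope.

(** Write k(z) = f(z)/z, so that k(0) = f'(0) = 1, and let omega be the Schwarz
    function with z f'/f - 1 = psi o omega. Along a ray of direction e the
    derivative of ln |k(t e)| is Re (z f'/f - 1) / t = Re psi(omega(t e)) / t.
    By the Schwarz lemma |omega(t e)| <= t, and the values of psi on the closed
    disc of radius t have modulus at most psi(t), so the derivative is at most
    psi(t)/t. Integrating from 0 to r gives |f(z)/z| <= M(r) ([growth_along_ray]),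
    which is more than the bound on the real part. Then
    f' = (f/z) (1 + psi o omega) gives |f'| <= (1 + psi(r)) M(r), and integrating
    |z f'| over the circle gives the bound on the length.

    The majorant psi(t) is increasing ([majorant_on_circles]): psi is real,
    continuous and injective on [0, 1), vanishes at 0 and is nonnegative.

    The Schwarz lemma ([schwarz]) has to be proved for functions that are only
    complex differentiable, so it rests on Goursat's theorem. This is done in
    real form: if U and V are differentiable with dU/dx = dV/dy, the flux
    through the boundary of a rectangle vanishes, by bisection
    ([green_rectangle]). In logarithmic polar coordinates it says that the mean
    of Re F over circles |z| = rho does not depend on rho, whence the mean value
    property at the centre ([mean_value]). The Schwarz lemma follows by applying
    it to omega(z)/z composed with a disc automorphism, so that every point
    takes its turn as the centre. *)

(** * Goursat's theorem on rectangles *)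

(** One bisection step on the rectangle (a, b, c, d), read as [a,b] x [c,d]: it
    returns a quarter on which [P] fails, when there is one. *)
Definition quarter_step (P : R -> R -> R -> R -> Prop) (s : R * R * R * R)
  : R * R * R * R :=
  let '(a, b, c, d) := s in
  let m := (a + b) / 2 in
  let n := (c + d) / 2 in
  if excluded_middle_informative (P a m c n) then
    if excluded_middle_informative (P m b c n) then
      if excluded_middle_informative (P a m n d) then (m, b, n, d)
      else (a, m, n, d)
    else (m, b, c, n)
  else (a, m, c, n).

(** Cousin's lemma in the plane. If [P] failed on the whole rectangle, it would
    fail on one of its quarters, and so on along a nested sequence; the
    rectangles shrink to a point, where the local hypothesis contradicts the
    failure. The point has to lie in the small rectangles: a differentiability
    estimate on a rectangle is only useful when the distance to the point does
    not exceed the size of the rectangle. *)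
Lemma rectangle_cousin (P : R -> R -> R -> R -> Prop) (a b c d : R) :
  a <= b -> c <= d ->
  (forall a' b' c' d', a <= a' <= b' -> b' <= b -> c <= c' <= d' -> d' <= d ->
     let m := (a' + b') / 2 in let n := (c' + d') / 2 in
     P a' m c' n -> P m b' c' n -> P a' m n d' -> P m b' n d' ->
     P a' b' c' d') ->
  (forall p q, a <= p <= b -> c <= q <= d ->
     exists delta, 0 < delta /\
       forall a' b' c' d', a <= a' <= p -> p <= b' <= b ->
         c <= c' <= q -> q <= d' <= d ->
         b' - a' < delta -> d' - c' < delta -> P a' b' c' d') ->
  P a b c d.
Proof.
  intros ab cd glue loc.
  destruct (excluded_middle_informative (P a b c d)) as [|bad]; [assumption|exfalso].
  set (s := fun n => Nat.iter n (quarter_step P) (a, b, c, d)).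
  set (A := fun n => fst (fst (fst (s n)))).
  set (B := fun n => snd (fst (fst (s n)))).
  set (A' := fun n => snd (fst (s n))).
  set (B' := fun n => snd (s n)).
  assert (sS : forall n, s (S n) = quarter_step P (s n)) by reflexivity.
  assert (inv : forall n,
    a <= A n <= B n /\ B n <= b /\ c <= A' n <= B' n /\ B' n <= d /\
    ~ P (A n) (B n) (A' n) (B' n)).
  { induction n as [|n IH].
    - unfold A, B, A', B', s; simpl; repeat split; lra || assumption.
    - unfold A, B, A', B' in *. rewrite sS.
      destruct (s n) as [[[x y] u] v]; simpl in *.
      destruct IH as (H1 & H2 & H3 & H4 & H5).
      specialize (glue x y u v H1 H2 H3 H4); simpl in glue.
      repeat destruct excluded_middle_informative; simpl;
        (repeat split; try lra; try assumption).
      intro; apply H5; auto. }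
  assert (step : forall n,
    A n <= A (S n) /\ B (S n) <= B n /\ A' n <= A' (S n) /\ B' (S n) <= B' n /\
    B (S n) - A (S n) = (B n - A n) / 2 /\
    B' (S n) - A' (S n) = (B' n - A' n) / 2).
  { intro n; generalize (inv n). unfold A, B, A', B' in *. rewrite sS.
    destruct (s n) as [[[x y] u] v]; simpl in *.
    intros (H1 & H2 & H3 & H4 & H5).
    repeat destruct excluded_middle_informative; simpl; lra. }
  assert (mono : forall n k,
    A n <= A (n + k)%nat /\ B (n + k)%nat <= B n /\
    A' n <= A' (n + k)%nat /\ B' (n + k)%nat <= B' n).
  { intros n k; induction k as [|k IH].
    - rewrite Nat.add_0_r; lra.
    - rewrite Nat.add_succ_r; generalize (step (n + k)%nat); lra. }
  assert (cross : forall n m, A n <= B m /\ A' n <= B' m).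
  { intros n m. generalize (mono n m) (mono m n) (inv (n + m)%nat).
    rewrite (Nat.add_comm m n). lra. }
  assert (len : forall n, B n - A n = (b - a) / 2 ^ n /\
                          B' n - A' n = (d - c) / 2 ^ n).
  { induction n as [|n IH].
    - unfold A, B, A', B', s; simpl; lra.
    - destruct (step n) as (_ & _ & _ & _ & -> & ->). destruct IH as [-> ->].
      simpl; split; field; apply pow_nonzero; lra. }
  destruct (completeness (fun x => exists n, x = A n)) as [p [p_ub p_lub]].
  { exists b; intros x [n ->]; generalize (inv n); lra. }
  { now exists (A 0%nat), 0%nat. }
  destruct (completeness (fun x => exists n, x = A' n)) as [q [q_ub q_lub]].
  { exists d; intros x [n ->]; generalize (inv n); lra. }
  { now exists (A' 0%nat), 0%nat. }
  assert (p_in : forall n, A n <= p <= B n).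
  { intro n; split; [apply p_ub; eauto|].
    apply p_lub; intros x [m ->]; apply cross. }
  assert (q_in : forall n, A' n <= q <= B' n).
  { intro n; split; [apply q_ub; eauto|].
    apply q_lub; intros x [m ->]; apply cross. }
  destruct (loc p q) as (delta & delta_pos & H).
  { generalize (p_in 0%nat) (inv 0%nat); lra. }
  { generalize (q_in 0%nat) (inv 0%nat); lra. }
  (* One number L exceeding both sides makes a single N serve for both; the
     added 1 keeps it positive when the rectangle is degenerate. *)
  set (L := (b - a) + (d - c) + 1).
  assert (L_pos : 0 < L) by (unfold L; lra).
  destruct (pow_lt_1_zero (/ 2)) with (y := delta / L) as [N HN].
  { rewrite Rabs_pos_eq; lra. }
  { apply Rdiv_lt_0_compat; lra. }
  specialize (HN N (le_n _)).
  rewrite Rabs_pos_eq in HN by (apply pow_le; lra).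
  rewrite pow_inv in HN.
  assert (pos : 0 < / 2 ^ N) by (apply Rinv_0_lt_compat, pow_lt; lra).
  assert (small : L * / 2 ^ N < delta).
  { apply Rmult_lt_reg_r with (/ L); [now apply Rinv_0_lt_compat|].
    replace (L * / 2 ^ N * / L) with (/ 2 ^ N); [exact HN|].
    field; split; try lra; apply pow_nonzero; lra. }
  destruct (inv N) as (H1 & H2 & H3 & H4 & H5).
  apply H5, H; try (generalize (p_in N) (q_in N); lra);
    destruct (len N) as [E E']; rewrite ?E, ?E'; unfold Rdiv;
    (eapply Rle_lt_trans; [|exact small]);
    apply Rmult_le_compat_r; unfold L; lra.
Qed.

Lemma RInt_near_const (g : R -> R) (a b k e : R) :
  a <= b -> ex_RInt g a b ->
  (forall x, a <= x <= b -> Rabs (g x - k) <= e) ->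
  Rabs (RInt g a b - k * (b - a)) <= (b - a) * e.
Proof.
  intros ab Hg H.
  assert (E : RInt (fun x => g x - k) a b = RInt g a b - k * (b - a)).
  { rewrite (RInt_minus (V := R_CompleteNormedModule) g (fun _ => k));
      [|exact Hg|apply ex_RInt_const].
    rewrite RInt_const. unfold minus, plus, opp, scal; simpl; unfold mult; simpl.
    ring. }
  rewrite <- E. apply abs_RInt_le_const; [exact ab| |exact H].
  apply (ex_RInt_minus (V := R_CompleteNormedModule) g (fun _ => k));
    [exact Hg|apply ex_RInt_const].
Qed.

Lemma continuity_2d_pt_section_l (f : R -> R -> R) (x y : R) :
  continuity_2d_pt f x y -> continuous (fun t => f t y) x.
Proof.
  intros H. apply continuity_pt_filterlim, continuity_pt_locally. intros eps.
  destruct (H eps) as [d Hd]. exists d. intros t Ht.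
  apply Hd; [exact Ht|]. rewrite Rminus_diag, Rabs_R0. apply cond_pos.
Qed.

Lemma continuity_2d_pt_section_r (f : R -> R -> R) (x y : R) :
  continuity_2d_pt f x y -> continuous (fun t => f x t) y.
Proof.
  intros H. apply continuity_pt_filterlim, continuity_pt_locally. intros eps.
  destruct (H eps) as [d Hd]. exists d. intros t Ht.
  apply Hd; [|exact Ht]. rewrite Rminus_diag, Rabs_R0. apply cond_pos.
Qed.

(** The circulation of U dy + V dx around the rectangle [a,b] x [c,d]; for
    U + i V a function of x + i y it is the real part of the contour
    integral divided by i. *)
Definition flux (U V : R -> R -> R) (a b c d : R) : R :=
  (RInt (U b) c d - RInt (U a) c d) -
  (RInt (fun x => V x d) a b - RInt (fun x => V x c) a b).

(** The single Cauchy-Riemann equation dU/dx = dV/dy, for functions that are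
    merely differentiable at the point: no continuity of the derivative. *)
Definition CR_half (U V : R -> R -> R) (x y : R) : Prop :=
  exists l m n, differentiable_pt_lim U x y l m /\ differentiable_pt_lim V x y n l.

Lemma CR_half_continuity (U V : R -> R -> R) (x y : R) :
  CR_half U V x y -> continuity_2d_pt U x y /\ continuity_2d_pt V x y.
Proof.
  intros (l & m & n & HU & HV).
  split; apply differentiable_continuity_pt; eexists; eexists; eassumption.
Qed.

(** Affine functions with dU/dx = dV/dy have zero flux, so only the remainders
    of the first-order expansions at (p, q) contribute. They are at most
    eps/4 (w + h) on a rectangle of sides w and h, over a perimeter
    2 (w + h), and (w + h)^2 is at most 2 (w^2 + h^2). Bounding by the sum of
    squares instead of the area spares all control of the ratio of the sides,
    and it still adds up exactly under bisection. *)
Lemma flux_local (U V : R -> R -> R) (p q eps : R) :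
  0 < eps -> CR_half U V p q ->
  exists delta, 0 < delta /\
    forall a b c d, a <= p <= b -> c <= q <= d ->
      b - a < delta -> d - c < delta ->
      (forall x y, a <= x <= b -> c <= y <= d -> CR_half U V x y) ->
      Rabs (flux U V a b c d) <= eps * ((b - a) ^ 2 + (d - c) ^ 2).
Proof.
  intros eps_pos (l & m & n & HU & HV).
  assert (e_pos : 0 < eps / 4) by lra.
  destruct (HU (mkposreal _ e_pos)) as [d1 H1].
  destruct (HV (mkposreal _ e_pos)) as [d2 H2]. simpl in H1, H2.
  exists (Rmin d1 d2). split; [apply Rmin_pos; apply cond_pos|].
  intros a b c d Hp Hq Hab Hcd HD.
  set (w := b - a) in *. set (h := d - c) in *.
  assert (m1 := Rmin_l d1 d2). assert (m2 := Rmin_r d1 d2).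
  assert (near : forall x y, a <= x <= b -> c <= y <= d ->
    Rabs (U x y - U p q - (l * (x - p) + m * (y - q))) <= eps / 4 * (w + h) /\
    Rabs (V x y - V p q - (n * (x - p) + l * (y - q))) <= eps / 4 * (w + h)).
  { intros x y Hx Hy.
    assert (X : Rabs (x - p) <= w) by (unfold w; apply Rabs_le; lra).
    assert (Y : Rabs (y - q) <= h) by (unfold h; apply Rabs_le; lra).
    assert (w0 := Rabs_pos (x - p)). assert (h0 := Rabs_pos (y - q)).
    assert (Mx : Rmax (Rabs (x - p)) (Rabs (y - q)) <= w + h)
      by (apply Rmax_lub; lra).
    split; (eapply Rle_trans; [apply H1 || apply H2; lra|]);
      apply Rmult_le_compat_l; lra. }
  assert (IU : forall x, a <= x <= b -> ex_RInt (U x) c d).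
  { intros x Hx. apply (ex_RInt_continuous (V := R_CompleteNormedModule)).
    intros y. rewrite Rmin_left, Rmax_right by lra. intros Hy.
    apply continuity_2d_pt_section_r, (CR_half_continuity U V), HD; assumption. }
  assert (IV : forall y, c <= y <= d -> ex_RInt (fun x => V x y) a b).
  { intros y Hy. apply (ex_RInt_continuous (V := R_CompleteNormedModule)).
    intros x. rewrite Rmin_left, Rmax_right by lra. intros Hx.
    apply continuity_2d_pt_section_l, (CR_half_continuity U V), HD; assumption. }
  unfold flux.
  rewrite <- (RInt_minus (V := R_CompleteNormedModule) (U b) (U a))
    by (apply IU; lra).
  rewrite <- (RInt_minus (V := R_CompleteNormedModule)
    (fun x => V x d) (fun x => V x c)) by (apply IV; lra).
  assert (J1 := RInt_near_const (fun y => minus (U b y) (U a y)) c d (l * w)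
    (eps / 2 * (w + h))).
  assert (J2 := RInt_near_const (fun x => minus (V x d) (V x c)) a b (l * h)
    (eps / 2 * (w + h))).
  fold w in J2. fold h in J1.
  lapply J1; [clear J1; intro J1|lra].
  lapply J1; [clear J1; intro J1|].
  2:{ apply (ex_RInt_minus (V := R_CompleteNormedModule) (U b) (U a));
        apply IU; lra. }
  lapply J1; [clear J1; intro J1|].
  2:{ intros y Hy. unfold minus, plus, opp; simpl.
      destruct (near b y) as [N1 _]; [lra|lra|].
      destruct (near a y) as [N2 _]; [lra|lra|].
      unfold w in *; apply Rabs_le; apply Rabs_le_between in N1, N2; lra. }
  lapply J2; [clear J2; intro J2|lra].
  lapply J2; [clear J2; intro J2|].
  2:{ apply (ex_RInt_minus (V := R_CompleteNormedModule)
        (fun x => V x d) (fun x => V x c)); apply IV; lra. }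
  lapply J2; [clear J2; intro J2|].
  2:{ intros x Hx. unfold minus, plus, opp; simpl.
      destruct (near x d) as [_ N1]; [lra|lra|].
      destruct (near x c) as [_ N2]; [lra|lra|].
      unfold h in *; apply Rabs_le; apply Rabs_le_between in N1, N2; lra. }
  apply Rabs_le_between in J1, J2.
  set (I1 := RInt _ c d) in *. set (I2 := RInt _ a b) in *.
  assert (0 <= eps * (w - h) ^ 2) by (apply Rmult_le_pos; [lra|apply pow2_ge_0]).
  apply Rabs_le. nra.
Qed.

(** Goursat's theorem in real form. The flux is additive under quartering, and
    so is the bound of [flux_local]: w^2 + h^2 summed over the four quarters
    gives back its value on the whole. Hence the local bound
    propagates to the rectangle, for every eps. *)
Lemma green_rectangle (U V : R -> R -> R) (a b c d : R) :
  a <= b -> c <= d ->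
  (forall x y, a <= x <= b -> c <= y <= d -> CR_half U V x y) ->
  flux U V a b c d = 0.
Proof.
  intros ab cd HD.
  assert (IU : forall x u v, a <= x <= b -> c <= u <= d -> c <= v <= d ->
    ex_RInt (U x) u v).
  { intros x u v Hx Hu Hv. apply (ex_RInt_continuous (V := R_CompleteNormedModule)).
    intros y Hy. apply continuity_2d_pt_section_r, (CR_half_continuity U V), HD;
      [assumption|].
    revert Hy; unfold Rmin, Rmax; destruct Rle_dec; lra. }
  assert (IV : forall y u v, c <= y <= d -> a <= u <= b -> a <= v <= b ->
    ex_RInt (fun x => V x y) u v).
  { intros y u v Hy Hu Hv. apply (ex_RInt_continuous (V := R_CompleteNormedModule)).
    intros x Hx. apply continuity_2d_pt_section_l, (CR_half_continuity U V), HD;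
      [|assumption].
    revert Hx; unfold Rmin, Rmax; destruct Rle_dec; lra. }
  assert (bound : forall eps, 0 < eps ->
    Rabs (flux U V a b c d) <= eps * ((b - a) ^ 2 + (d - c) ^ 2)).
  { intros eps eps_pos.
    apply (rectangle_cousin (fun a b c d =>
      Rabs (flux U V a b c d) <= eps * ((b - a) ^ 2 + (d - c) ^ 2)));
      [assumption|assumption| |].
    - intros a' b' c' d' Ha Hb Hc Hd m n K1 K2 K3 K4.
      assert (E : flux U V a' b' c' d' =
        flux U V a' m c' n + flux U V m b' c' n +
        flux U V a' m n d' + flux U V m b' n d').
      { unfold flux.
        assert (CU : forall x, a <= x <= b ->
          RInt (U x) c' d' = RInt (U x) c' n + RInt (U x) n d').
        { intros x Hx. symmetry.
          apply (RInt_Chasles (V := R_CompleteNormedModule)); apply IU;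
            unfold n; lra. }
        assert (CV : forall y, c <= y <= d ->
          RInt (fun x => V x y) a' b' =
          RInt (fun x => V x y) a' m + RInt (fun x => V x y) m b').
        { intros y Hy. symmetry.
          apply (RInt_Chasles (V := R_CompleteNormedModule)
            (fun x => V x y)); apply IV; unfold m; lra. }
        rewrite !CU, !CV by lra. ring. }
      rewrite E. apply Rabs_le_between in K1, K2, K3, K4.
      apply Rabs_le.
      unfold m, n in K1, K2, K3, K4 |- *. split; nra.
    - intros p q Hp Hq.
      destruct (flux_local U V p q eps eps_pos (HD p q Hp Hq)) as (delta & Hd & H).
      exists delta; split; [exact Hd|].
      intros a' b' c' d' Ha Hb Hc Hd' W Hh. apply H; try lra.
      intros x y Hx Hy. apply HD; lra. }
  set (S := (b - a) ^ 2 + (d - c) ^ 2) in *.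
  assert (S_nonneg : 0 <= S)
    by (unfold S; generalize (pow2_ge_0 (b - a)) (pow2_ge_0 (d - c)); lra).
  destruct (Req_dec (flux U V a b c d) 0) as [|nz]; [assumption|exfalso].
  apply Rabs_pos_lt in nz.
  assert (e_pos : 0 < Rabs (flux U V a b c d) / (2 * (S + 1)))
    by (apply Rdiv_lt_0_compat; lra).
  specialize (bound _ e_pos). revert bound. apply Rlt_not_le.
  set (F := Rabs _) in *.
  replace (F / (2 * (S + 1)) * S) with (F * (S / (2 * (S + 1)))) by (field; lra).
  rewrite <- (Rmult_1_r F) at 2. apply Rmult_lt_compat_l; [assumption|].
  apply Rmult_lt_reg_r with (2 * (S + 1)); [lra|]. unfold Rdiv.
  rewrite Rmult_assoc, Rinv_l; lra.
Qed.

(** * Complex differentiability and the Cauchy-Riemann equations *)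

(** [C] carries two uniform structures, with discs and with squares as balls.
    The one with discs is the metric of [Cmod]; the algebra of continuous
    functions is stated for it. *)
Definition C_metric : UniformSpace := AbsRing_UniformSpace C_AbsRing.

Definition C_continuous (F : C -> C) (z : C) : Prop :=
  @continuous C_metric C_metric F z.

(** Carathéodory's form of the derivative: F w - F z is a multiple of w - z with
    a factor continuous at z. Sums, products, inverses and compositions become
    algebraic identities between such factors, and the factor itself is the
    continuous extension of the difference quotient. *)
Definition cdiff (F : C -> C) (z l : C) : Prop :=
  exists q : C -> C,
    C_continuous q z /\ q z = l /\
    @locally C_metric z (fun w => (F w - F z = q w * (w - z))%C).

Lemma C_continuous_eps (F : C -> C) (z : C) :
  C_continuous F z <->
  forall eps : posreal, exists delta : posreal, forall w,
    Cmod (w - z) < delta -> Cmod (F w - F z) < eps.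
Proof.
  split.
  - intros H eps. destruct (proj1 (filterlim_locally _ _) H eps) as [d Hd].
    exists d. exact Hd.
  - intros H. apply filterlim_locally. intros eps.
    destruct (H eps) as [d Hd]. exists d. exact Hd.
Qed.

Lemma cdiff_continuous (F : C -> C) (z l : C) :
  cdiff F z l -> C_continuous F z.
Proof.
  intros (q & Hq & _ & E).
  apply (continuous_ext_loc (T := C_metric) (U := C_metric) F
    (fun w => F z + q w * (w - z))%C).
  { revert E. apply filter_imp. intros w E.
    change (@eq C (F z + q w * (w - z))%C (F w)). rewrite <- E. ring. }
  apply (continuous_plus (U := C_metric) (V := AbsRing_NormedModule C_AbsRing)
    (fun _ => F z) (fun w => q w * (w - z))%C).
  { apply continuous_const. }
  apply (continuous_mult (U := C_metric) (K := C_AbsRing) q (fun w => (w - z)%C));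
    [exact Hq|].
  apply (continuous_minus (U := C_metric) (V := AbsRing_NormedModule C_AbsRing)
    (fun w => w) (fun _ => z)); [apply continuous_id|apply continuous_const].
Qed.

Lemma is_derive_cdiff (F : C -> C) (z l : C) :
  is_derive (K := C_AbsRing) (V := C_NormedModule) F z l -> cdiff F z l.
Proof.
  intros [_ H]. specialize (H z (fun P p => p)).
  exists (fun w => if Ceq_dec w z then l else ((F w - F z) / (w - z))%C).
  split; [|split].
  - apply C_continuous_eps. intros eps.
    assert (e_pos : 0 < eps / 2) by (generalize (cond_pos eps); lra).
    destruct (H (mkposreal _ e_pos)) as [d Hd]. exists d. intros w Hw.
    destruct (Ceq_dec z z) as [_|]; [|congruence].
    destruct (Ceq_dec w z) as [_|nz].
    { replace (l - l)%C with (RtoC 0) by ring. rewrite Cmod_0. apply cond_pos. }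
    specialize (Hd w Hw).
    change (Cmod ((F w - F z) - (w - z) * l) <= eps / 2 * Cmod (w - z)) in Hd.
    assert (nz' : (w - z <> 0)%C).
    { intro E. apply nz. replace w with (w - z + z)%C by ring. rewrite E. ring. }
    replace ((F w - F z) / (w - z) - l)%C
      with (((F w - F z) - (w - z) * l) / (w - z))%C by (field; exact nz').
    rewrite Cmod_div by exact nz'.
    apply Cmod_gt_0 in nz'.
    apply Rmult_lt_reg_r with (Cmod (w - z)); [exact nz'|].
    unfold Rdiv. rewrite Rmult_assoc, Rinv_l, Rmult_1_r by lra.
    eapply Rle_lt_trans; [exact Hd|]. apply Rmult_lt_compat_r; simpl; lra.
  - destruct (Ceq_dec z z); [reflexivity|congruence].
  - apply filter_forall. intros w. destruct (Ceq_dec w z) as [->|nz]; [ring|].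
    field. intro E. apply nz. replace w with (w - z + z)%C by ring. rewrite E. ring.
Qed.

(** Compares the squares of the product structure with discs. *)
Lemma box_Cmod (x y u v d : R) :
  Rabs (u - x) < d / 2 -> Rabs (v - y) < d / 2 -> Cmod ((u, v) - (x, y))%C < d.
Proof.
  intros Hu Hv. eapply Rle_lt_trans; [apply Cmod_2Rmax|]. simpl.
  fold (u - x) (v - y).
  assert (Rmax (Rabs (u - x)) (Rabs (v - y)) < d / 2) by (apply Rmax_lub_lt; lra).
  assert (0 <= Rabs (u - x)) by apply Rabs_pos.
  assert (sqrt 2 <= 2).
  { rewrite <- (sqrt_square 2) at 2 by lra. apply sqrt_le_1; lra. }
  assert (0 < sqrt 2) by (apply sqrt_lt_R0; lra).
  assert (Rabs (u - x) <= Rmax (Rabs (u - x)) (Rabs (v - y))) by apply Rmax_l.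
  nra.
Qed.

Lemma im_le_Cmod (z : C) : Rabs (Im z) <= Cmod z.
Proof. eapply Rle_trans; [|apply Rmax_Cmod]. apply Rmax_r. Qed.

Lemma C_continuous_Re_Im (F : C -> C) (x y : R) :
  C_continuous F (x, y) ->
  continuity_2d_pt (fun x y => Re (F (x, y))) x y /\
  continuity_2d_pt (fun x y => Im (F (x, y))) x y.
Proof.
  intros H. rewrite C_continuous_eps in H.
  split; intros eps; destruct (H eps) as [d Hd].
  all: assert (d_pos : 0 < d / 2) by (generalize (cond_pos d); lra).
  all: exists (mkposreal _ d_pos); intros u v Hu Hv; simpl in Hu, Hv.
  all: eapply Rle_lt_trans; [|apply (Hd (u, v)), box_Cmod; assumption].
  - apply (re_le_Cmod (F (u, v) - F (x, y))%C).
  - apply (im_le_Cmod (F (u, v) - F (x, y))%C).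
Qed.

Lemma cauchy_riemann (F : C -> C) (x y : R) (l : C) :
  cdiff F (x, y) l ->
  differentiable_pt_lim (fun x y => Re (F (x, y))) x y (Re l) (- Im l) /\
  differentiable_pt_lim (fun x y => Im (F (x, y))) x y (Im l) (Re l).
Proof.
  intros (q & Hq & <- & [d0 E]). rewrite C_continuous_eps in Hq.
  assert (K : forall eps : posreal, locally_2d (fun u v =>
    Cmod (F (u, v) - F (x, y) - q (x, y) * ((u, v) - (x, y)))%C <=
    eps * Rmax (Rabs (u - x)) (Rabs (v - y))) x y).
  { intros eps.
    assert (e_pos : 0 < eps / 2) by (generalize (cond_pos eps); lra).
    destruct (Hq (mkposreal _ e_pos)) as [d Hd]. simpl in Hd.
    assert (d_pos : 0 < Rmin d d0 / 2)
      by (generalize (Rmin_pos d d0 (cond_pos d) (cond_pos d0)); lra).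
    exists (mkposreal _ d_pos); intros u v Hu Hv; simpl in Hu, Hv.
    assert (M1 := Rmin_l d d0). assert (M2 := Rmin_r d d0).
    assert (B := box_Cmod _ _ _ _ _ Hu Hv).
    rewrite (E (u, v)) by (change (Cmod ((u, v) - (x, y)) < d0); lra).
    replace (q (u, v) * ((u, v) - (x, y)) - q (x, y) * ((u, v) - (x, y)))%C
      with ((q (u, v) - q (x, y)) * ((u, v) - (x, y)))%C by ring.
    rewrite Cmod_mult.
    assert (S := Cmod_2Rmax ((u, v) - (x, y))%C). simpl in S.
    fold (u - x) (v - y) in S.
    assert (sqrt 2 <= 2).
    { rewrite <- (sqrt_square 2) at 2 by lra. apply sqrt_le_1; lra. }
    specialize (Hd (u, v) (Rlt_le_trans _ _ _ B M1)).
    assert (0 <= Rabs (u - x)) by apply Rabs_pos.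
    assert (Rabs (u - x) <= Rmax (Rabs (u - x)) (Rabs (v - y))) by apply Rmax_l.
    assert (G := Cmod_ge_0 (q (u, v) - q (x, y))%C).
    assert (G' := Cmod_ge_0 ((u, v) - (x, y))%C).
    apply Rle_trans with (eps / 2 * (2 * Rmax (Rabs (u - x)) (Rabs (v - y)))).
    - apply Rmult_le_compat; [assumption|assumption|lra|].
      eapply Rle_trans; [exact S|]. apply Rmult_le_compat_r; lra.
    - lra. }
  split; intros eps; generalize (K eps); apply locally_2d_impl, locally_2d_forall;
    intros u v; apply Rle_trans.
  - eapply Rle_trans; [|apply re_le_Cmod]. right. f_equal.
    destruct (F (u, v)), (F (x, y)), (q (x, y)); simpl; ring.
  - eapply Rle_trans; [|apply im_le_Cmod]. right. f_equal.
    destruct (F (u, v)), (F (x, y)), (q (x, y)); simpl; ring.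
Qed.

(** * The mean value property *)

(** Uniform continuity of [U] across the compact segment turns pointwise
    closeness of the integrands into closeness of the integrals. *)
Lemma continuous_RInt_parameter (U : R -> R -> R) (x c d : R) :
  c <= d ->
  (forall y, c <= y <= d -> continuity_2d_pt U x y) ->
  locally x (fun t => ex_RInt (U t) c d) ->
  continuous (fun t => RInt (U t) c d) x.
Proof.
  intros cd HU HI.
  apply continuity_pt_filterlim, continuity_pt_locally. intros eps.
  assert (e_pos : 0 < eps / (d - c + 1))
    by (apply Rdiv_lt_0_compat; [apply cond_pos|lra]).
  destruct (uniform_continuity_2d_1d' U c d x) with (eps := mkposreal _ e_pos)
    as [d1 H1].
  { exact HU. }
  destruct HI as [d2 H2].
  assert (m_pos : 0 < Rmin d1 d2) by (apply Rmin_pos; apply cond_pos).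
  exists (mkposreal _ m_pos). intros t Ht. change (Rabs (t - x) < Rmin d1 d2) in Ht.
  assert (M1 := Rmin_l d1 d2). assert (M2 := Rmin_r d1 d2).
  assert (Ix : ex_RInt (U x) c d) by (apply H2, ball_center).
  assert (It : ex_RInt (U t) c d).
  { apply H2. change (Rabs (t - x) < d2). lra. }
  change (Rabs (minus (RInt (U t) c d) (RInt (U x) c d)) < eps).
  rewrite <- (RInt_minus (V := R_CompleteNormedModule) (U t) (U x))
    by assumption.
  eapply Rle_lt_trans.
  { apply abs_RInt_le_const with (M := eps / (d - c + 1)); [assumption| |].
    - apply (ex_RInt_minus (V := R_CompleteNormedModule) (U t) (U x)); assumption.
    - intros y Hy. left. apply (H1 y x y t); try lra.
      + apply Rabs_lt_between in Ht. simpl in t. lra.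
      + rewrite Rminus_diag, Rabs_R0. apply cond_pos. }
  assert (0 < eps) by apply cond_pos.
  replace ((d - c) * (eps / (d - c + 1))) with (eps * ((d - c) / (d - c + 1)))
    by (field; lra).
  rewrite <- (Rmult_1_r eps) at 2. apply Rmult_lt_compat_l; [assumption|].
  apply Rmult_lt_reg_r with (d - c + 1); [lra|]. unfold Rdiv.
  rewrite Rmult_assoc, Rinv_l; lra.
Qed.

Definition polar (rho theta : R) : C := (rho * cos theta, rho * sin theta).

Lemma Cmod_polar (rho theta : R) : Cmod (polar rho theta) = Rabs rho.
Proof.
  unfold Cmod, polar; simpl.
  replace (rho * cos theta * (rho * cos theta * 1) +
           rho * sin theta * (rho * sin theta * 1)) with (Rsqr rho).
  - apply sqrt_Rsqr_abs.
  - generalize (sin2_cos2 theta). unfold Rsqr. intros E.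
    replace (rho * rho) with
      (rho * rho * (sin theta * sin theta + cos theta * cos theta))
      by (rewrite E; ring). ring.
Qed.

Definition circle_mean (F : C -> C) (rho : R) : R :=
  RInt (fun theta => Re (F (polar rho theta))) 0 (2 * PI).

Lemma continuity_2d_pt_polar (F : C -> C) (rho theta : R) :
  C_continuous F (polar rho theta) ->
  continuity_2d_pt (fun rho theta => Re (F (polar rho theta))) rho theta.
Proof.
  intros H. apply C_continuous_Re_Im, proj1 in H.
  apply continuity_2d_pt_filterlim in H. apply continuity_2d_pt_filterlim.
  unfold polar in *.
  assert (H1 : forall g, continuous g theta -> continuous
    (fun z : R * R => fst z * g (snd z)) (rho, theta)).
  { intros g Hg. apply (continuous_mult (K := R_AbsRing)
      (fun z : R * R => fst z) (fun z => g (snd z))).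
    - apply continuous_fst.
    - apply (continuous_comp (fun z : R * R => snd z) g);
        [apply continuous_snd|exact Hg]. }
  apply (continuous_comp_2 (fun z : R * R => fst z * cos (snd z))
    (fun z : R * R => fst z * sin (snd z)) (fun x y => Re (F (x, y)))
    (rho, theta)).
  - apply H1, continuous_cos.
  - apply H1, continuous_sin.
  - exact H.
Qed.

Lemma differentiable_pt_lim_separated (f g : R -> R) (x y f' g' : R) :
  derivable_pt_lim f x f' -> derivable_pt_lim g y g' ->
  differentiable_pt_lim (fun x y => f x * g y) x y (f' * g y) (f x * g').
Proof.
  intros Hf Hg.
  assert (P : forall a b, differentiable_pt_lim Rmult a b b a).
  { intros a b eps. exists eps. intros u v Hu Hv.
    replace (u * v - a * b - (b * (u - a) + a * (v - b)))
      with ((u - a) * (v - b)) by ring.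
    rewrite Rabs_mult. apply Rmult_le_compat; try apply Rabs_pos; [lra|].
    apply Rmax_r. }
  assert (snd_diff : differentiable_pt_lim (fun _ v : R => v) x y 0 1).
  { intros eps. exists eps. intros u v _ _.
    replace (v - y - (0 * (u - x) + 1 * (v - y))) with 0 by ring.
    rewrite Rabs_R0. apply Rmult_le_pos; [left; apply cond_pos|].
    eapply Rle_trans; [apply Rabs_pos|apply Rmax_l]. }
  assert (D := differentiable_pt_lim_comp Rmult (fun u _ => f u) (fun _ v => g v)
    x y _ _ _ _ _ _ (P _ _)
    (differentiable_pt_lim_proj1_0 f x y f' Hf)
    (differentiable_pt_lim_comp (fun u _ => g u) (fun _ v => v) (fun _ _ => 0)
      x y _ _ _ _ 0 0
      (differentiable_pt_lim_proj1_0 g y 0 g' Hg) snd_diff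
      (differentiable_pt_lim_proj1_0 (fun _ => 0) x y 0
         (derivable_pt_lim_const 0 x)))).
  match type of D with differentiable_pt_lim _ _ _ ?l ?m =>
    replace (f' * g y) with l by ring; replace (f x * g') with m by ring end.
  exact D.
Qed.

(** In the coordinate s + i t = log z the function F (exp (s + i t)) is again
    complex differentiable, so it satisfies the Cauchy-Riemann equations there;
    circles become vertical segments of length 2 pi. *)
Lemma CR_half_log_polar (F : C -> C) (s t : R) (l : C) :
  cdiff F (polar (exp s) t) l ->
  CR_half (fun s t => Re (F (polar (exp s) t)))
          (fun s t => Im (F (polar (exp s) t))) s t.
Proof.
  intros H. apply cauchy_riemann in H. destruct H as [HR HI].
  assert (Hc := differentiable_pt_lim_separated exp cos s t _ _
    (derivable_pt_lim_exp s) (derivable_pt_lim_cos t)).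
  assert (Hs := differentiable_pt_lim_separated exp sin s t _ _
    (derivable_pt_lim_exp s) (derivable_pt_lim_sin t)).
  assert (DR := differentiable_pt_lim_comp _ _ _ _ _ _ _ _ _ _ _ HR Hc Hs).
  assert (DI := differentiable_pt_lim_comp _ _ _ _ _ _ _ _ _ _ _ HI Hc Hs).
  eexists. eexists. eexists. split; [exact DR|].
  match type of DI with differentiable_pt_lim _ _ _ _ ?m =>
    match goal with |- differentiable_pt_lim _ _ _ _ ?k =>
      replace k with m by ring end end.
  exact DI.
Qed.

(** In logarithmic coordinates the annulus is a rectangle whose two horizontal
    sides t = 0 and t = 2 pi cancel by periodicity, so the vanishing flux
    compares the two vertical sides. *)
Lemma circle_mean_annulus (F : C -> C) (r1 r2 : R) :
  0 < r1 -> r1 <= r2 ->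
  (forall z, r1 <= Cmod z <= r2 -> exists l, cdiff F z l) ->
  circle_mean F r1 = circle_mean F r2.
Proof.
  intros r1_pos r12 HF.
  assert (G : flux (fun s t => Re (F (polar (exp s) t)))
    (fun s t => Im (F (polar (exp s) t))) (ln r1) (ln r2) 0 (2 * PI) = 0).
  { apply green_rectangle.
    - apply ln_le; lra.
    - generalize PI_RGT_0; lra.
    - intros s t [Hs1 Hs2] _.
      destruct (HF (polar (exp s) t)) as [l Hl].
      + rewrite Cmod_polar, Rabs_pos_eq by (left; apply exp_pos).
        rewrite <- (exp_ln r1), <- (exp_ln r2) by lra.
        split; [destruct Hs1 as [K| ->]|destruct Hs2 as [K| ->]];
          try apply Rle_refl; left; apply exp_increasing, K.
      + now apply CR_half_log_polar with l. }
  unfold flux in G. rewrite !exp_ln in G by lra.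
  rewrite (RInt_ext (fun x => Im (F (polar (exp x) (2 * PI))))
    (fun x => Im (F (polar (exp x) 0)))) in G.
  - unfold circle_mean. lra.
  - intros x _. unfold polar. now rewrite cos_2PI, sin_2PI, cos_0, sin_0.
Qed.

Lemma continuous_circle_mean (F : C -> C) (rho : R) :
  (forall z, Cmod z < 1 -> C_continuous F z) ->
  Rabs rho < 1 -> continuous (circle_mean F) rho.
Proof.
  intros HF Hrho.
  apply (continuous_RInt_parameter (fun rho theta => Re (F (polar rho theta)))).
  - generalize PI_RGT_0; lra.
  - intros y _. apply continuity_2d_pt_polar, HF. now rewrite Cmod_polar.
  - assert (e_pos : 0 < 1 - Rabs rho) by lra.
    exists (mkposreal _ e_pos). intros t Ht.
    change (Rabs (t - rho) < 1 - Rabs rho) in Ht.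
    apply (ex_RInt_continuous (V := R_CompleteNormedModule)). intros y _.
    apply (continuity_2d_pt_section_r (fun rho theta => Re (F (polar rho theta)))).
    apply continuity_2d_pt_polar, HF. rewrite Cmod_polar.
    replace t with (t - rho + rho) by ring.
    eapply Rle_lt_trans; [apply Rabs_triang|]. simpl in t; lra.
Qed.

Lemma constant_inside_eq_ends (I : R -> R) (a b : R) :
  a < b -> continuous I a -> continuous I b ->
  (forall x y, a < x < b -> a < y < b -> I x = I y) -> I a = I b.
Proof.
  intros ab Ha Hb HI.
  assert (lim : forall c, a <= c <= b -> continuous I c -> I c = I ((a + b) / 2)).
  { intros c Hc Ic.
    destruct (Req_dec (I c) (I ((a + b) / 2))) as [|ne]; [assumption|exfalso].
    apply Rminus_eq_contra, Rabs_pos_lt in ne.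
    apply continuity_pt_filterlim in Ic.
    destruct (proj1 (continuity_pt_locally _ _) Ic (mkposreal _ ne)) as [d Hd].
    set (e := Rmin (d / 2) ((b - a) / 4)).
    assert (E1 : e <= d / 2) by apply Rmin_l.
    assert (E2 : e <= (b - a) / 4) by apply Rmin_r.
    assert (d_pos := cond_pos d).
    assert (E3 : 0 < e) by (apply Rmin_pos; lra).
    assert (near : exists x, a < x < b /\ Rabs (x - c) < d).
    { destruct (Rle_lt_dec c ((a + b) / 2)).
      - exists (c + e). split; [lra|]. apply Rabs_lt_between; lra.
      - exists (c - e). split; [lra|]. apply Rabs_lt_between; lra. }
    destruct near as (x & Hx & Hxc).
    specialize (Hd x Hxc). simpl in Hd.
    rewrite (HI x ((a + b) / 2)) in Hd by lra.
    rewrite Rabs_minus_sym in Hd. lra. }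
  rewrite (lim a), (lim b); [reflexivity|lra|assumption|lra|assumption].
Qed.

(** The mean is constant in the radius on each side of the circle of radius [q],
    and continuous across it, so points of that circle where F is only
    continuous do no harm. Such an exceptional circle lets a quotient be used
    through its removable singularity before it is known to be
    differentiable there. *)
Lemma mean_value (F : C -> C) (q rho : R) :
  (forall z, Cmod z < 1 -> C_continuous F z) ->
  (forall z, Cmod z < 1 -> Cmod z <> q -> exists l, cdiff F z l) ->
  0 <= rho < 1 ->
  circle_mean F rho = 2 * PI * Re (F (RtoC 0)).
Proof.
  intros HC HD Hrho.
  transitivity (circle_mean F 0).
  2:{ unfold circle_mean.
      rewrite (RInt_ext _ (fun _ => Re (F (RtoC 0)))).
      - rewrite RInt_const. unfold scal; simpl; unfold mult; simpl. ring.
      - intros t _. unfold polar. now rewrite !Rmult_0_l. }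
  assert (cont : forall x, 0 <= x < 1 -> continuous (circle_mean F) x).
  { intros x Hx. apply continuous_circle_mean; [exact HC|].
    rewrite Rabs_pos_eq; lra. }
  assert (ann : forall a b, 0 <= a -> b < 1 -> (q <= a \/ b <= q) ->
    forall x y, a < x < b -> a < y < b -> circle_mean F x = circle_mean F y).
  { intros a b Ha Hb Hq.
    assert (W : forall x y, a < x < b -> a < y < b -> x <= y ->
      circle_mean F x = circle_mean F y).
    { intros x y Hx Hy xy. apply circle_mean_annulus; [lra|exact xy|].
      intros z Hz. apply HD; lra. }
    intros x y Hx Hy. destruct (Rle_lt_dec x y); [now apply W|].
    symmetry; apply W; lra. }
  assert (seg : forall a b, 0 <= a -> a <= b -> b < 1 -> (q <= a \/ b <= q) ->
    circle_mean F a = circle_mean F b).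
  { intros a b Ha [ab| ->] Hb Hq; [|reflexivity].
    apply constant_inside_eq_ends; [exact ab|apply cont; lra|apply cont; lra|].
    now apply ann. }
  destruct (Rle_lt_dec q 0); [symmetry; apply seg; lra|].
  destruct (Rle_lt_dec rho q); [symmetry; apply seg; lra|].
  rewrite <- (seg q rho) by lra. symmetry; apply seg; lra.
Qed.

(** * Algebra of complex differentiable functions *)

Lemma C_continuous_const (c z : C) : C_continuous (fun _ => c) z.
Proof. apply (continuous_const (U := C_metric) (V := C_metric)). Qed.

Lemma C_continuous_id (z : C) : C_continuous (fun w => w) z.
Proof. apply (continuous_id (U := C_metric)). Qed.

Lemma C_continuous_plus (F G : C -> C) (z : C) :
  C_continuous F z -> C_continuous G z -> C_continuous (fun w => F w + G w)%C z.
Proof.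
  apply (continuous_plus (U := C_metric) (V := AbsRing_NormedModule C_AbsRing)).
Qed.

Lemma C_continuous_mult (F G : C -> C) (z : C) :
  C_continuous F z -> C_continuous G z -> C_continuous (fun w => F w * G w)%C z.
Proof. apply (continuous_mult (U := C_metric) (K := C_AbsRing)). Qed.

Lemma C_continuous_comp (F G : C -> C) (z : C) :
  C_continuous G z -> C_continuous F (G z) -> C_continuous (fun w => F (G w)) z.
Proof.
  apply (continuous_comp (U := C_metric) (V := C_metric) (W := C_metric) G F).
Qed.

Lemma C_continuous_ext_loc (F G : C -> C) (z : C) :
  @locally C_metric z (fun w => F w = G w) -> C_continuous F z -> C_continuous G z.
Proof. apply (continuous_ext_loc (T := C_metric) (U := C_metric) G F). Qed.

Lemma locally_neq (a b : C) : a <> b -> @locally C_metric a (fun w => w <> b).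
Proof.
  intros ab.
  assert (pos : 0 < Cmod (b - a)).
  { apply Cmod_gt_0. intro E. apply ab. symmetry.
    replace b with (b - a + a)%C by ring. rewrite E. ring. }
  exists (mkposreal _ pos). intros w Hw ->.
  change (Cmod (b - a) < Cmod (b - a)) in Hw. lra.
Qed.

Lemma C_continuous_inv (a : C) : a <> RtoC 0 -> C_continuous Cinv a.
Proof.
  intros nz. apply C_continuous_eps. intros eps.
  assert (pos := proj1 (Cmod_gt_0 a) nz). assert (e_pos := cond_pos eps).
  assert (d_pos : 0 < Rmin (Cmod a / 2) (eps * (Cmod a * Cmod a / 2))).
  { apply Rmin_pos; [lra|]. apply Rmult_lt_0_compat; nra. }
  exists (mkposreal _ d_pos). intros w Hw. simpl in Hw.
  assert (M1 := Rmin_l (Cmod a / 2) (eps * (Cmod a * Cmod a / 2))).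
  assert (M2 := Rmin_r (Cmod a / 2) (eps * (Cmod a * Cmod a / 2))).
  assert (big : Cmod a / 2 < Cmod w).
  { assert (T := Cmod_triangle w (- (w - a))%C).
    rewrite Cmod_opp in T. replace (w + - (w - a))%C with a in T by ring. lra. }
  assert (wz : w <> RtoC 0).
  { apply Cmod_gt_0. lra. }
  replace (/ w - / a)%C with (- (w - a) / (w * a))%C by (field; split; assumption).
  rewrite Cmod_div, Cmod_opp, Cmod_mult.
  2:{ now apply Cmult_neq_0. }
  assert (0 < Cmod w * Cmod a) by (apply Rmult_lt_0_compat; lra).
  apply Rmult_lt_reg_r with (Cmod w * Cmod a); [assumption|].
  unfold Rdiv. rewrite Rmult_assoc, Rinv_l, Rmult_1_r by lra.
  assert (Cmod a * Cmod a / 2 <= Cmod w * Cmod a) by nra.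
  assert (eps * (Cmod a * Cmod a / 2) <= eps * (Cmod w * Cmod a))
    by (apply Rmult_le_compat_l; lra).
  lra.
Qed.

Lemma cdiff_const (c z : C) : cdiff (fun _ => c) z (RtoC 0).
Proof.
  exists (fun _ => RtoC 0). split; [apply C_continuous_const|split; [reflexivity|]].
  apply filter_forall. intros w. ring.
Qed.

Lemma cdiff_id (z : C) : cdiff (fun w => w) z (RtoC 1).
Proof.
  exists (fun _ => RtoC 1). split; [apply C_continuous_const|split; [reflexivity|]].
  apply filter_forall. intros w. ring.
Qed.

Lemma cdiff_plus (F G : C -> C) (z l m : C) :
  cdiff F z l -> cdiff G z m -> cdiff (fun w => F w + G w)%C z (l + m)%C.
Proof.
  intros (p & Hp & <- & EF) (q & Hq & <- & EG).
  exists (fun w => p w + q w)%C.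
  split; [now apply C_continuous_plus|split; [reflexivity|]].
  generalize (filter_and _ _ EF EG). apply filter_imp. intros w [E E'].
  replace (F w + G w - (F z + G z))%C with ((F w - F z) + (G w - G z))%C by ring.
  rewrite E, E'. ring.
Qed.

Lemma cdiff_mult (F G : C -> C) (z l m : C) :
  cdiff F z l -> cdiff G z m ->
  cdiff (fun w => F w * G w)%C z (l * G z + F z * m)%C.
Proof.
  intros HF HG. assert (CG := cdiff_continuous G z m HG).
  destruct HF as (p & Hp & <- & EF), HG as (q & Hq & <- & EG).
  exists (fun w => p w * G w + F z * q w)%C.
  split; [|split; [reflexivity|]].
  - apply C_continuous_plus; apply C_continuous_mult; try assumption.
    apply C_continuous_const.
  - generalize (filter_and _ _ EF EG). apply filter_imp. intros w [E E'].
    replace (F w * G w - F z * G z)%C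
      with ((F w - F z) * G w + F z * (G w - G z))%C by ring.
    rewrite E, E'. ring.
Qed.

Lemma cdiff_inv (a : C) : a <> RtoC 0 -> cdiff Cinv a (- / (a * a))%C.
Proof.
  intros nz. exists (fun w => - / a * / w)%C. split; [|split].
  - apply C_continuous_mult; [apply C_continuous_const|now apply C_continuous_inv].
  - field. exact nz.
  - generalize (locally_neq a (RtoC 0) nz). apply filter_imp. intros w wz.
    field. split; assumption.
Qed.

Lemma cdiff_comp (F G : C -> C) (z l m : C) :
  cdiff G z m -> cdiff F (G z) l -> cdiff (fun w => F (G w)) z (l * m)%C.
Proof.
  intros HG HF. assert (CG := cdiff_continuous G z m HG).
  destruct HF as (p & Hp & <- & EF), HG as (q & Hq & <- & EG).
  exists (fun w => p (G w) * q w)%C. split; [|split; [reflexivity|]].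
  - apply C_continuous_mult; [|assumption]. now apply C_continuous_comp.
  - assert (EF' : @locally C_metric z
      (fun w => (F (G w) - F (G z) = p (G w) * (G w - G z))%C)) by exact (CG _ EF).
    generalize (filter_and _ _ EF' EG). apply filter_imp. intros w [E E'].
    rewrite E, E'. ring.
Qed.

(** * The Schwarz lemma *)

(** The disc automorphism that sends 0 to w. *)
Definition moebius (w z : C) : C := ((z + w) / (1 + Cconj w * z))%C.

Lemma Cmod_sqr (z : C) : Cmod z * Cmod z = Re z * Re z + Im z * Im z.
Proof. generalize (Cmod2_alt z). simpl. rewrite !Rmult_1_r. trivial. Qed.

Lemma moebius_denominator (w z : C) :
  Cmod w < 1 -> Cmod z < 1 -> 1 - Cmod w <= Cmod (1 + Cconj w * z)%C.
Proof.
  intros Hw Hz.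
  assert (T := Cmod_triangle (1 + Cconj w * z)%C (- (Cconj w * z))%C).
  rewrite Cmod_opp, Cmod_mult, Cmod_conj in T.
  replace (1 + Cconj w * z + - (Cconj w * z))%C with (RtoC 1) in T by ring.
  rewrite Cmod_1 in T.
  assert (Cmod w * Cmod z <= Cmod w * 1)
    by (apply Rmult_le_compat_l; [apply Cmod_ge_0|lra]). lra.
Qed.

Lemma moebius_denominator_neq_0 (w z : C) :
  Cmod w < 1 -> Cmod z < 1 -> (1 + Cconj w * z)%C <> RtoC 0.
Proof.
  intros Hw Hz. apply Cmod_gt_0. generalize (moebius_denominator w z Hw Hz). lra.
Qed.

(** The classical identity behind the invariance of the disc: it measures the
    distance of the image to the unit circle. *)
Lemma moebius_identity (w z : C) :
  Cmod w < 1 -> Cmod z < 1 ->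
  (1 - Cmod (moebius w z) * Cmod (moebius w z)) *
    (Cmod (1 + Cconj w * z) * Cmod (1 + Cconj w * z)) =
  (1 - Cmod z * Cmod z) * (1 - Cmod w * Cmod w).
Proof.
  intros Hw Hz. assert (nz := moebius_denominator_neq_0 w z Hw Hz).
  unfold moebius. rewrite Cmod_div by exact nz.
  assert (pos := proj1 (Cmod_gt_0 _) nz).
  transitivity (Cmod (1 + Cconj w * z) * Cmod (1 + Cconj w * z) -
    Cmod (z + w) * Cmod (z + w)).
  { field. lra. }
  rewrite !Cmod_sqr. destruct z, w; simpl. ring.
Qed.

(** Circles close to the unit circle have images close to it, uniformly: by
    [moebius_identity], the deficit 1 - |image|^2 is at most
    (1 - |z|^2) / (1 - |w|)^2. *)
Lemma moebius_lower (w z : C) (e : R) :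
  Cmod w < 1 -> Cmod z < 1 -> 0 <= e <= 1 ->
  1 - Cmod z * Cmod z = e * ((1 - Cmod w) * (1 - Cmod w)) ->
  1 - e <= Cmod (moebius w z).
Proof.
  intros Hw Hz He E.
  assert (I := moebius_identity w z Hw Hz).
  assert (D := moebius_denominator w z Hw Hz).
  assert (w0 := Cmod_ge_0 w). assert (z0 := Cmod_ge_0 z).
  assert (p0 := Cmod_ge_0 (moebius w z)).
  set (p := Cmod (moebius w z)) in *. set (d := Cmod (1 + _)) in *.
  set (s := 1 - Cmod w) in *.
  assert (s_pos : 0 < s) by (unfold s; lra).
  assert (0 < s * s) by nra. assert (s * s <= d * d) by nra.
  assert (0 <= 1 - Cmod w * Cmod w <= 1) by nra.
  assert (up : (1 - p * p) * (d * d) <= e * (d * d)).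
  { rewrite I, E. rewrite <- (Rmult_1_r (e * (d * d))).
    apply Rmult_le_compat; nra. }
  assert (low : 0 <= (1 - p * p) * (d * d)).
  { rewrite I. apply Rmult_le_pos; nra. }
  assert (0 < d * d) by lra.
  assert (1 - p * p <= e) by (apply Rmult_le_reg_r with (d * d); assumption).
  assert (0 <= 1 - p * p).
  { apply Rmult_le_reg_r with (d * d); [assumption|]. lra. }
  nra.
Qed.

Lemma moebius_disc (w z : C) :
  Cmod w < 1 -> Cmod z < 1 -> Cmod (moebius w z) < 1.
Proof.
  intros Hw Hz.
  assert (I := moebius_identity w z Hw Hz).
  assert (D := moebius_denominator w z Hw Hz).
  assert (w0 := Cmod_ge_0 w). assert (z0 := Cmod_ge_0 z).
  set (p := Cmod (moebius w z)) in *. set (d := Cmod (1 + _)) in *.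
  destruct (Rlt_le_dec p 1) as [|p1]; [assumption|exfalso].
  assert (0 < (1 - Cmod z * Cmod z) * (1 - Cmod w * Cmod w))
    by (apply Rmult_lt_0_compat; nra).
  assert (0 <= d * d) by nra. assert (1 <= p * p) by nra. nra.
Qed.

Lemma cdiff_moebius (w z : C) :
  Cmod w < 1 -> Cmod z < 1 -> exists l, cdiff (moebius w) z l.
Proof.
  intros Hw Hz. eexists. unfold moebius, Cdiv.
  apply cdiff_mult.
  - apply cdiff_plus; [apply cdiff_id|apply cdiff_const].
  - apply (cdiff_comp Cinv (fun z => 1 + Cconj w * z)%C).
    + apply cdiff_plus; [apply cdiff_const|].
      apply cdiff_mult; [apply cdiff_const|apply cdiff_id].
    + apply cdiff_inv, moebius_denominator_neq_0; assumption.
Qed.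

(** Division by z at a zero: the Carathéodory factor at 0 shows that the
    quotient is continuous there. *)
Lemma quotient_by_z (F : C -> C) (l0 : C) :
  (forall z, Cmod z < 1 -> exists l, cdiff F z l) ->
  F (RtoC 0) = RtoC 0 -> cdiff F (RtoC 0) l0 ->
  exists k : C -> C,
    k (RtoC 0) = l0 /\
    (forall z, z <> RtoC 0 -> k z = (F z / z)%C) /\
    (forall z, Cmod z < 1 -> C_continuous k z) /\
    (forall z l, z <> RtoC 0 -> cdiff F z l ->
       cdiff k z (l / z - F z / (z * z))%C).
Proof.
  intros HD H0 (q & Hq & ql & Eq).
  set (k := fun z => if Ceq_dec z (RtoC 0) then l0 else (F z / z)%C).
  assert (k_nz : forall z, z <> RtoC 0 -> k z = (F z / z)%C).
  { intros z nz. unfold k. now destruct Ceq_dec. }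
  assert (kD : forall z l, z <> RtoC 0 -> cdiff F z l ->
    cdiff k z (l / z - F z / (z * z))%C).
  { intros z l nz Hl.
    destruct (cdiff_mult _ _ _ _ _ Hl (cdiff_inv z nz)) as (p & Hp & Ep & E).
    exists p. split; [exact Hp|split].
    - rewrite Ep. field. exact nz.
    - generalize (filter_and _ _ E (locally_neq z (RtoC 0) nz)).
      apply filter_imp. intros y [Ey ny]. rewrite !k_nz by assumption. exact Ey. }
  exists k. split; [|split; [exact k_nz|split; [|exact kD]]].
  { unfold k. destruct Ceq_dec; congruence. }
  intros z Hz. destruct (Ceq_dec z (RtoC 0)) as [->|nz].
  - apply (C_continuous_ext_loc q); [|exact Hq].
    revert Eq. apply filter_imp. intros y E. unfold k.
    destruct (Ceq_dec y (RtoC 0)) as [->|ny]; [exact ql|].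
    rewrite H0 in E. replace (F y) with (F y - 0)%C by ring.
    rewrite E. field. exact ny.
  - destruct (HD z Hz) as [m Hm]. exact (cdiff_continuous k z _ (kD z m nz Hm)).
Qed.

(** With omega(z) = z k(z), the claim is |k(w)| <= 1. The function k composed
    with the automorphism sending 0 to w is continuous on the disc and
    differentiable off the preimage of 0, which lies on the circle of radius
    |w|; so k(w) is the mean of the composed function over circles about 0. The
    automorphism maps circles close to the unit circle to points zeta with
    |zeta| close to 1, where |k(zeta)| <= 1 / |zeta|. *)
Lemma schwarz (omega : C -> C) (w : C) :
  (forall z, Cmod z < 1 -> exists l, cdiff omega z l) ->
  (forall z, Cmod z < 1 -> Cmod (omega z) < 1) ->
  omega (RtoC 0) = RtoC 0 ->
  Cmod w < 1 -> Cmod (omega w) <= Cmod w.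
Proof.
  intros HD HB H0 Hw.
  destruct (Ceq_dec w (RtoC 0)) as [->|wz].
  { rewrite H0. apply Rle_refl. }
  destruct (HD (RtoC 0)) as [l Hl]. { rewrite Cmod_0; lra. }
  destruct (quotient_by_z omega l HD H0 Hl) as (k & _ & k_nz & kC & kD).
  (* The factor conj(k w) makes the value at 0 the real number |k w|^2, so that
     the mean value of the real part suffices. *)
  set (F := fun z => (Cconj (k w) * k (moebius w z))%C).
  assert (FC : forall z, Cmod z < 1 -> C_continuous F z).
  { intros z Hz. apply C_continuous_mult; [apply C_continuous_const|].
    apply C_continuous_comp; [|now apply kC, moebius_disc].
    destruct (cdiff_moebius w z Hw Hz) as [m Hm].
    exact (cdiff_continuous _ _ _ Hm). }
  assert (FD : forall z, Cmod z < 1 -> Cmod z <> Cmod w -> exists m, cdiff F z m).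
  { intros z Hz ne. destruct (cdiff_moebius w z Hw Hz) as [m Hm].
    destruct (HD (moebius w z)) as [l' Hl']. { now apply moebius_disc. }
    assert (nz : moebius w z <> RtoC 0).
    { intro E. apply ne. unfold moebius in E.
      assert (zw : (z + w = 0)%C).
      { replace (z + w)%C with ((z + w) / (1 + Cconj w * z) *
          (1 + Cconj w * z))%C by (field; now apply moebius_denominator_neq_0).
        rewrite E. ring. }
      replace z with (z + w - w)%C by ring. rewrite zw.
      replace (0 - w)%C with (- w)%C by ring. apply Cmod_opp. }
    eexists. apply cdiff_mult; [apply cdiff_const|].
    apply cdiff_comp; [exact Hm|exact (kD _ _ nz Hl')]. }
  assert (F0 : Re (F (RtoC 0)) = Cmod (k w) * Cmod (k w)).
  { unfold F. replace (moebius w (RtoC 0)) with w.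
    - rewrite Cmod_sqr. destruct (k w); simpl; ring.
    - unfold moebius. field. }
  assert (bound : forall e, 0 < e < 1 -> Cmod (k w) * (1 - e) <= 1).
  { intros e He.
    (* The radius rho = sqrt (1 - e s) is the one for which [moebius_lower] keeps
       the image at modulus at least 1 - e. *)
    set (s := (1 - Cmod w) * (1 - Cmod w)).
    assert (w0 := Cmod_ge_0 w).
    assert (s01 : 0 < s <= 1) by (unfold s; nra).
    assert (es : 0 < e * s < 1) by nra.
    set (rho := sqrt (1 - e * s)).
    assert (rho2 : rho * rho = 1 - e * s) by (apply sqrt_sqrt; lra).
    assert (rho0 : 0 <= rho) by apply sqrt_pos.
    assert (rho1 : rho < 1) by nra.
    assert (k0 := Cmod_ge_0 (k w)).
    assert (MV := mean_value F (Cmod w) rho FC FD (conj rho0 rho1)).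
    rewrite F0 in MV.
    assert (on_circle : forall t,
      Rabs (Re (F (polar rho t))) <= Cmod (k w) * / (1 - e)).
    { intros t.
      assert (Mz : Cmod (polar rho t) = rho)
        by (rewrite Cmod_polar; now apply Rabs_pos_eq).
      eapply Rle_trans; [apply re_le_Cmod|].
      unfold F. rewrite Cmod_mult, Cmod_conj.
      apply Rmult_le_compat_l; [exact k0|].
      assert (low : 1 - e <= Cmod (moebius w (polar rho t))).
      { apply moebius_lower;
          [exact Hw|lra|lra|rewrite Mz, rho2; unfold s; ring]. }
      assert (nz : moebius w (polar rho t) <> RtoC 0)
        by (apply Cmod_gt_0; lra).
      rewrite k_nz, Cmod_div by exact nz.
      assert (up := HB (moebius w (polar rho t))).
      assert (md := moebius_disc w (polar rho t) Hw).
      rewrite Mz in md. specialize (up (md rho1)).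
      unfold Rdiv. rewrite <- (Rmult_1_l (/ (1 - e))).
      apply Rmult_le_compat; [apply Cmod_ge_0| |lra|].
      - left. apply Rinv_0_lt_compat. lra.
      - apply Rinv_le_contravar; lra. }
    assert (PI_pos := PI_RGT_0).
    assert (IB : Rabs (circle_mean F rho) <=
      (2 * PI - 0) * (Cmod (k w) * / (1 - e))).
    { apply abs_RInt_le_const; [lra| |].
      - apply (ex_RInt_continuous (V := R_CompleteNormedModule)). intros y _.
        apply (continuity_2d_pt_section_r
          (fun rho theta => Re (F (polar rho theta)))).
        apply continuity_2d_pt_polar, FC. rewrite Cmod_polar, Rabs_pos_eq; lra.
      - intros t _. apply on_circle. }
    rewrite MV, Rabs_pos_eq in IB
      by (apply Rmult_le_pos; [lra|now apply Rmult_le_pos]).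
    destruct (Req_dec (Cmod (k w)) 0) as [->|kz]; [lra|].
    assert (K : Cmod (k w) <= / (1 - e)).
    { apply Rmult_le_reg_l with (2 * PI * Cmod (k w));
        [apply Rmult_lt_0_compat; lra|]. lra. }
    apply Rmult_le_compat_r with (r := 1 - e) in K; [|lra].
    rewrite Rinv_l in K; lra. }
  assert (kw : Cmod (k w) <= 1).
  { destruct (Rle_lt_dec (Cmod (k w)) 1) as [|big]; [assumption|exfalso].
    assert (B := bound ((1 - / Cmod (k w)) / 2)).
    assert (0 < / Cmod (k w)) by (apply Rinv_0_lt_compat; lra).
    assert (I : Cmod (k w) * / Cmod (k w) = 1) by (apply Rinv_r; lra).
    assert (/ Cmod (k w) < 1) by nra.
    nra. }
  replace (omega w) with (k w * w)%C by (rewrite k_nz by exact wz; field; exact wz).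
  rewrite Cmod_mult. rewrite <- (Rmult_1_l (Cmod w)) at 2.
  apply Rmult_le_compat_r; [apply Cmod_ge_0|exact kw].
Qed.

(** * Functions along curves and rays *)

Lemma continuous_into_C_metric (x y : R -> R) (t : R) :
  continuous x t -> continuous y t ->
  @continuous R_UniformSpace C_metric (fun t => (x t, y t)) t.
Proof.
  intros Hx Hy. apply filterlim_locally. intros eps.
  assert (e_pos : 0 < eps / 2) by (generalize (cond_pos eps); lra).
  generalize (filter_and _ _
    (proj1 (filterlim_locally _ _) Hx (mkposreal _ e_pos))
    (proj1 (filterlim_locally _ _) Hy (mkposreal _ e_pos))).
  apply filter_imp. intros s [K1 K2].
  change (Cmod ((x s, y s) - (x t, y t))%C < eps). now apply box_Cmod.
Qed.

(** Used with h the real part or the modulus, both 1-Lipschitz. *)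
Lemma continuous_along_curve (h : C -> R) (F : C -> C) (gamma : R -> C) (t : R) :
  (forall z w, Rabs (h w - h z) <= Cmod (w - z)) ->
  @continuous R_UniformSpace C_metric gamma t -> C_continuous F (gamma t) ->
  continuous (fun s => h (F (gamma s))) t.
Proof.
  intros Hh Hg HF.
  apply (continuous_comp (U := R_UniformSpace) (V := C_metric) (W := R_UniformSpace)
    (fun s => F (gamma s)) h).
  - now apply (continuous_comp (U := R_UniformSpace) (V := C_metric) (W := C_metric)).
  - apply filterlim_locally. intros eps. exists eps. intros w Hw.
    change (Rabs (h w - h (F (gamma t))) < eps).
    eapply Rle_lt_trans; [apply Hh|exact Hw].
Qed.

Lemma Re_lipschitz (z w : C) : Rabs (Re w - Re z) <= Cmod (w - z).
Proof. apply (re_le_Cmod (w - z)%C). Qed.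

Lemma Cmod_lipschitz (z w : C) : Rabs (Cmod w - Cmod z) <= Cmod (w - z).
Proof.
  assert (T := Cmod_triangle (w - z)%C z). assert (T' := Cmod_triangle (- (w - z))%C w).
  replace (w - z + z)%C with w in T by ring.
  replace (- (w - z) + w)%C with z in T' by ring.
  rewrite Cmod_opp in T'. apply Rabs_le. lra.
Qed.

Lemma continuous_RtoC (t : R) : @continuous R_UniformSpace C_metric RtoC t.
Proof.
  apply (continuous_into_C_metric (fun s => s) (fun _ => 0));
    [apply continuous_id|apply continuous_const].
Qed.

Lemma continuous_polar (rho t : R) :
  @continuous R_UniformSpace C_metric (polar rho) t.
Proof.
  apply (continuous_into_C_metric (fun t => rho * cos t) (fun t => rho * sin t)).
  - apply (continuous_mult (K := R_AbsRing) (fun _ : R => rho) cos);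
      [apply continuous_const|apply continuous_cos].
  - apply (continuous_mult (K := R_AbsRing) (fun _ : R => rho) sin);
      [apply continuous_const|apply continuous_sin].
Qed.

Definition ray (e : C) (t : R) : C := (t * Re e, t * Im e).

Lemma ray_eq (e : C) (t : R) : ray e t = (RtoC t * e)%C.
Proof. destruct e. unfold ray, Cmult. simpl. f_equal; ring. Qed.

Lemma Cmod_ray (e : C) (t : R) : Cmod (ray e t) = Rabs t * Cmod e.
Proof. rewrite ray_eq, Cmod_mult, Cmod_R. reflexivity. Qed.

Lemma continuous_ray (e : C) (t : R) :
  @continuous R_UniformSpace C_metric (ray e) t.
Proof.
  apply (continuous_into_C_metric (fun s => s * Re e) (fun s => s * Im e));
    apply (continuous_mult (K := R_AbsRing) (fun s : R => s));
    (apply continuous_id || apply continuous_const).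
Qed.

Lemma is_derive_ray (F : C -> C) (e m : C) (t : R) :
  cdiff F (ray e t) m ->
  is_derive (fun s => Re (F (ray e s))) t (Re (m * e)%C) /\
  is_derive (fun s => Im (F (ray e s))) t (Im (m * e)%C).
Proof.
  intros H. apply cauchy_riemann in H. destruct H as [HR HI].
  assert (L : forall c, derivable_pt_lim (fun s => s * c) t c).
  { intros c. apply is_derive_Reals. auto_derive; [exact I|ring]. }
  assert (DR := derivable_pt_lim_comp_2d _ _ _ _ _ _ _ _ HR (L _) (L _)).
  assert (DI := derivable_pt_lim_comp_2d _ _ _ _ _ _ _ _ HI (L _) (L _)).
  split; apply is_derive_Reals.
  - replace (Re (m * e)%C) with (Re m * Re e + - Im m * Im e); [exact DR|].
    destruct m, e; simpl; ring.
  - replace (Im (m * e)%C) with (Im m * Re e + Re m * Im e); [exact DI|].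
    destruct m, e; simpl; ring.
Qed.

(** ln |F| is the real part of log F, whose derivative along the ray is
    e F' / F. *)
Lemma is_derive_ln_Cmod_ray (F : C -> C) (e m : C) (t : R) :
  cdiff F (ray e t) m -> F (ray e t) <> RtoC 0 ->
  is_derive (fun s => ln (Cmod (F (ray e s)))) t (Re (m * e / F (ray e t))%C).
Proof.
  intros H nz. apply is_derive_ray in H. destruct H as [HR HI].
  set (u := fun s => Re (F (ray e s))) in *.
  set (v := fun s => Im (F (ray e s))) in *.
  assert (pos : 0 < u t ^ 2 + v t ^ 2).
  { apply Cmod_gt_0 in nz. generalize (Cmod2_alt (F (ray e t))).
    fold (u t) (v t). intros <-. now apply pow_lt. }
  change (is_derive (fun s => ln (sqrt (u s ^ 2 + v s ^ 2))) t
    (Re (m * e / F (ray e t))%C)).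
  replace (Re (m * e / F (ray e t))%C) with
    ((u t * Re (m * e)%C + v t * Im (m * e)%C) / (u t ^ 2 + v t ^ 2)).
  - assert (Eu : ex_derive u t) by (eexists; exact HR).
    assert (Ev : ex_derive v t) by (eexists; exact HI).
    assert (sp : 0 < sqrt (u t ^ 2 + v t ^ 2)) by now apply sqrt_lt_R0.
    auto_derive.
    + replace (u t * (u t * 1) + v t * (v t * 1)) with (u t ^ 2 + v t ^ 2) by ring.
      repeat split; assumption.
    + change (fun x => u x) with u. change (fun x => v x) with v.
      rewrite (is_derive_unique u t _ HR), (is_derive_unique v t _ HI).
      replace (u t * (u t * 1) + v t * (v t * 1)) with (u t ^ 2 + v t ^ 2) by ring.
      assert (sq := sqrt_sqrt _ (Rlt_le _ _ pos)).
      set (q := sqrt (u t ^ 2 + v t ^ 2)) in *.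
      rewrite <- sq. field. lra.
  - unfold u, v in *. destruct (F (ray e t)) as [x y], (m * e)%C as [a b].
    simpl in *. field. lra.
Qed.

(** Differentiation of real power series gives this on each coordinate: along
    the real axis, Re f and Im f are the sums of the real series with
    coefficients Re a and Im a. *)
Lemma power_series_derivative_at_0 (a : nat -> C) (f : C -> C) (l : C) :
  (forall z, Cmod z < 1 ->
     is_pseries (K := C_AbsRing) (V := C_NormedModule) a z (f z)) ->
  cdiff f (RtoC 0) l -> l = a 1%nat.
Proof.
  intros Hf Hl.
  (* h stands for Re or Im: an additive, real-homogeneous and continuous
     coordinate. *)
  assert (coord : forall h : C -> R,
    (forall z w, h (z + w)%C = h z + h w) ->
    (forall (s : R) z, h (RtoC s * z)%C = s * h z) ->
    (forall z w, Rabs (h w - h z) <= Cmod (w - z)) ->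
    forall m, is_derive (fun s => h (f (RtoC s))) 0 m -> m = h (a 1%nat)).
  { intros h h_add h_scal h_lip m Hm.
    assert (S : forall t, Rabs t < 1 ->
      is_pseries (fun n => h (a n)) t (h (f (RtoC t)))).
    { intros t Ht. assert (Z := Hf (RtoC t)). rewrite Cmod_R in Z. specialize (Z Ht).
      assert (E : forall n, sum_n (fun k => scal (pow_n t k) (h (a k))) n =
        h (@sum_n C_NormedModule (fun k => scal (pow_n (K := C_AbsRing) (RtoC t) k) (a k)) n)).
      { assert (P : forall n, pow_n (K := C_AbsRing) (RtoC t) n = RtoC (pow_n t n)).
        { induction n as [|n IH]; [reflexivity|]. simpl. rewrite IH.
          change (RtoC t * RtoC (pow_n t n) = RtoC (t * pow_n t n))%C.
          now rewrite RtoC_mult. }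
        assert (T : forall n, scal (pow_n t n) (h (a n)) =
          h (scal (pow_n (K := C_AbsRing) (RtoC t) n) (a n : C_NormedModule))).
        { intros n. rewrite P. symmetry. apply h_scal. }
        induction n as [|n IH].
        - rewrite !sum_O. apply T.
        - rewrite !sum_Sn, IH, T. symmetry. apply h_add. }
      unfold is_pseries, is_series in *.
      apply (filterlim_ext (fun n => h (@sum_n C_NormedModule
        (fun k => scal (pow_n (K := C_AbsRing) (RtoC t) k) (a k)) n))).
      { intros n. symmetry. apply E. }
      eapply filterlim_comp; [exact Z|].
      apply filterlim_locally. intros eps.
      apply locally_C. exists eps. intros w Hw.
      change (Rabs (h w - h (f (RtoC t))) < eps).
      eapply Rle_lt_trans; [apply h_lip|exact Hw]. }
    (* Convergence at 1/2 makes the radius of convergence positive. *)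
    assert (radius : Rbar_lt (Rabs 0) (CV_radius (fun n => h (a n)))).
    { destruct (Rbar_le_lt_dec (Finite (/ 2)) (CV_radius (fun n => h (a n)))) as [K|K].
      - eapply Rbar_lt_le_trans; [|exact K]. simpl. rewrite Rabs_R0. lra.
      - exfalso. apply (CV_disk_outside (fun n => h (a n)) (/ 2)).
        + rewrite Rabs_pos_eq; [exact K|lra].
        + apply ex_series_lim_0. exists (h (f (RtoC (/ 2)))).
          eapply is_series_ext; [|apply (S (/ 2)); rewrite Rabs_pos_eq; lra].
          intros n. simpl. rewrite pow_n_pow. unfold scal; simpl; unfold mult; simpl.
          apply Rmult_comm. }
    assert (D := is_derive_PSeries _ _ radius).
    rewrite PSeries_0 in D. unfold PS_derive in D.
    assert (D' : is_derive (fun s => h (f (RtoC s))) 0 (INR 1 * h (a 1%nat))).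
    { eapply is_derive_ext_loc; [|exact D].
      exists (mkposreal 1 Rlt_0_1). intros t Ht. apply is_pseries_unique, S.
      change (Rabs (t - 0) < 1) in Ht. now rewrite Rminus_0_r in Ht. }
    apply is_derive_unique in Hm. apply is_derive_unique in D'.
    rewrite <- Hm, D'. simpl. ring. }
  assert (R1 : forall s, ray (RtoC 1) s = RtoC s).
  { intros s. rewrite ray_eq. ring. }
  assert (Hl' : cdiff f (ray (RtoC 1) 0) l) by now rewrite R1.
  apply is_derive_ray in Hl'. rewrite Cmult_1_r in Hl'. destruct Hl' as [HR HI].
  assert (ER : Re l = Re (a 1%nat)).
  { apply (coord Re).
    - reflexivity.
    - intros s [x y]. simpl. ring.
    - apply Re_lipschitz.
    - eapply is_derive_ext; [|exact HR]. intros s. cbv beta. now rewrite R1. }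
  assert (EI : Im l = Im (a 1%nat)).
  { apply (coord Im).
    - reflexivity.
    - intros s [x y]. simpl. ring.
    - intros z w. apply (im_le_Cmod (w - z)%C).
    - eapply is_derive_ext; [|exact HI]. intros s. cbv beta. now rewrite R1. }
  destruct l, (a 1%nat). simpl in *. congruence.
Qed.

(** * Growth, distortion and length *)

Lemma cdiff_disc (F : C -> C) (z : C) :
  analytic_disc F -> Cmod z < 1 -> cdiff F z (C_derive F z).
Proof.
  intros HF Hz. apply is_derive_cdiff, C_derive_correct; [exact z|]. now apply HF.
Qed.

(** If p s > p t for some s < t, the intermediate value theorem on [0, s] would
    give a point of [0, s] where p takes the value p t, although p is
    injective and t lies beyond s. *)
Lemma nonneg_injective_increasing (p : R -> R) :
  (forall t, 0 <= t < 1 -> continuous p t) ->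
  (forall s t, 0 <= s < 1 -> 0 <= t < 1 -> p s = p t -> s = t) ->
  p 0 = 0 -> (forall t, 0 < t < 1 -> 0 <= p t) ->
  forall s t, 0 < s -> s <= t -> t < 1 -> p s <= p t.
Proof.
  intros cont inj p0 nonneg s t Hs Hst Ht.
  destruct (Rle_lt_dec (p s) (p t)) as [|lt]; [assumption|exfalso].
  assert (pt : 0 < p t).
  { destruct (nonneg t) as [|E]; [lra|assumption|].
    assert (t = 0) by (apply inj; lra). lra. }
  destruct (IVT_interv (fun x => p x - p t) 0 s) as (x & Hx & Ex); try lra.
  - intros x Hx. apply continuity_pt_minus.
    + apply continuity_pt_filterlim, cont. lra.
    + now apply continuity_pt_const.
  - assert (x = t) by (apply inj; lra).
    replace x with s in * by lra. lra.
Qed.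

(** The maximum of |psi| on |z| = s is psi(s), hence psi is real and nonnegative
    on [0, 1), and univalence makes it increase with s. This plays the part of
    the maximum principle for psi. *)
Lemma majorant_on_circles (psi : C -> C) :
  univalent_disc psi -> psi (RtoC 0) = RtoC 0 ->
  (forall r : R, 0 < r < 1 ->
     is_circle_max (fun z => Cmod (psi z)) r (psi (RtoC r))) ->
  forall (z : C) (t : R), 0 < t < 1 -> Cmod z <= t ->
    Cmod (psi z) <= Re (psi (RtoC t)).
Proof.
  intros [psi_an psi_inj] psi0 Hmax z t Ht Hz.
  set (p := fun t => Re (psi (RtoC t))).
  assert (real : forall s, 0 <= s < 1 -> psi (RtoC s) = RtoC (p s)).
  { intros s [[Hs| <-] Hs1].
    - destruct (Hmax s (conj Hs Hs1)) as (m & E & _). unfold p. now rewrite E.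
    - unfold p. now rewrite psi0. }
  assert (bound : forall w, 0 < Cmod w < 1 -> Cmod (psi w) <= p (Cmod w)).
  { intros w Hw. destruct (Hmax (Cmod w) Hw) as (m & E & _ & B).
    unfold p. rewrite E. now apply B. }
  assert (nonneg : forall s, 0 < s < 1 -> 0 <= p s).
  { intros s Hs. assert (Es : Cmod (RtoC s) = s)
      by (rewrite Cmod_R; apply Rabs_pos_eq; lra).
    assert (B := bound (RtoC s)). rewrite Es in B.
    eapply Rle_trans; [apply Cmod_ge_0|now apply B]. }
  destruct (Req_dec (Cmod z) 0) as [z0|z0].
  { apply Cmod_eq_0 in z0. rewrite z0, psi0, Cmod_0. now apply nonneg. }
  assert (zp := Cmod_ge_0 z).
  apply Rle_trans with (p (Cmod z)); [apply bound; lra|].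
  change (p (Cmod z) <= p t).
  apply nonneg_injective_increasing; try lra; try assumption.
  - intros s Hs. apply (continuous_along_curve Re psi RtoC).
    + apply Re_lipschitz.
    + apply continuous_RtoC.
    + apply (cdiff_continuous _ _ (C_derive psi (RtoC s))), cdiff_disc;
        [assumption|]. rewrite Cmod_R, Rabs_pos_eq; lra.
  - intros s u Hs Hu E. apply RtoC_inj, psi_inj.
    + unfold Defs.disc. rewrite Cmod_R, Rabs_pos_eq; lra.
    + unfold Defs.disc. rewrite Cmod_R, Rabs_pos_eq; lra.
    + rewrite !real by assumption. now rewrite E.
  - unfold p. now rewrite psi0.
Qed.

(** ln |F| has derivative Re (e F' / F) <= h along the ray of direction e; the
    mean value theorem compares it with the primitive of h. *)
Lemma growth_along_ray (F : C -> C) (h : R -> R) (e : C) (r : R) :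
  0 < r < 1 -> Cmod e = 1 ->
  (forall z, Cmod z < 1 -> C_continuous F z) ->
  (forall z, Cmod z < 1 -> F z <> RtoC 0) ->
  (forall t, -1 < t < 1 -> continuous h t) ->
  (forall t, 0 < t < 1 -> exists m,
     cdiff F (ray e t) m /\ Re (m * e / F (ray e t))%C <= h t) ->
  Cmod (F (ray e r)) <= Cmod (F (RtoC 0)) * exp (RInt h 0 r).
Proof.
  intros Hr He FC F_nz hC HD.
  assert (small : forall t, 0 <= t <= r -> Cmod (ray e t) < 1).
  { intros t Ht. rewrite Cmod_ray, He, Rabs_pos_eq; lra. }
  assert (pos : forall t, 0 <= t <= r -> 0 < Cmod (F (ray e t))).
  { intros t Ht. apply Cmod_gt_0, F_nz, small, Ht. }
  assert (hD : forall t, 0 <= t <= r -> is_derive (fun t => RInt h 0 t) t (h t)).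
  { intros t Ht. apply (is_derive_RInt h _ 0); [|apply hC; lra].
    assert (d_pos : 0 < 1 - t) by lra.
    exists (mkposreal _ d_pos). intros s Hs. change (Rabs (s - t) < 1 - t) in Hs.
    apply Rabs_lt_between in Hs. simpl in s.
    apply (RInt_correct (V := R_CompleteNormedModule)),
      (ex_RInt_continuous (V := R_CompleteNormedModule)).
    intros x Hx. apply hC. revert Hx. unfold Rmin, Rmax. destruct Rle_dec; lra. }
  (* The intermediate point of the mean value theorem may be the endpoint 0,
     where no derivative is given: the value 0 there is a harmless filler. *)
  set (df := fun t => if Rle_dec t 0 then 0 else
    Derive (fun s => ln (Cmod (F (ray e s)))) t - h t).
  destruct (MVT_gen (fun t => ln (Cmod (F (ray e t))) - RInt h 0 t) 0 r df)
    as (c & Hc & E).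
  - rewrite Rmin_left, Rmax_right by lra. intros t Ht.
    destruct (HD t) as (m & Hm & _); [lra|].
    assert (D := is_derive_ln_Cmod_ray F e m t Hm
      (F_nz _ (small t (conj (Rlt_le _ _ (proj1 Ht)) (Rlt_le _ _ (proj2 Ht)))))).
    unfold df. destruct Rle_dec as [bad|_]; [lra|].
    apply (is_derive_minus (V := R_NormedModule)
      (fun s => ln (Cmod (F (ray e s)))) (fun t => RInt h 0 t)).
    + apply Derive_correct. eexists. exact D.
    + apply hD. lra.
  - rewrite Rmin_left, Rmax_right by lra. intros t Ht.
    apply continuity_pt_filterlim.
    apply (continuous_minus (V := R_NormedModule)
      (fun s => ln (Cmod (F (ray e s)))) (fun t => RInt h 0 t)).
    + apply (continuous_comp (fun s => Cmod (F (ray e s))) ln).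
      * apply (continuous_along_curve Cmod F (ray e)).
        -- apply Cmod_lipschitz.
        -- apply continuous_ray.
        -- now apply FC, small.
      * apply (ex_derive_continuous (K := R_AbsRing) (V := R_NormedModule)).
        exists (/ Cmod (F (ray e t))).
        apply is_derive_Reals, derivable_pt_lim_ln. now apply pos.
    + apply (ex_derive_continuous (V := R_NormedModule)).
      eexists. apply hD. exact Ht.
  - rewrite Rmin_left, Rmax_right in Hc by lra.
    assert (Hdf : df c <= 0).
    { unfold df. destruct Rle_dec as [_|c_pos]; [lra|].
      destruct (HD c) as (m & Hm & B); [lra|].
      assert (D := is_derive_ln_Cmod_ray F e m c Hm (F_nz _ (small c Hc))).
      apply is_derive_unique in D.
      change (Derive (fun s : R => ln (Cmod (F (ray e s)))) c =
        Re (m * e / F (ray e c))%C) in D.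
      rewrite D. lra. }
    rewrite RInt_point in E. unfold zero in E; simpl in E.
    replace (ray e 0) with (RtoC 0) in E by (unfold ray; now rewrite !Rmult_0_l).
    assert (p0 := pos 0). assert (pr := pos r).
    replace (ray e 0) with (RtoC 0) in p0 by (unfold ray; now rewrite !Rmult_0_l).
    rewrite <- (exp_ln (Cmod (F (ray e r)))), <- (exp_ln (Cmod (F (RtoC 0))))
      by (apply pr || apply p0; lra).
    rewrite <- exp_plus.
    assert (L : ln (Cmod (F (ray e r))) <= ln (Cmod (F (RtoC 0))) + RInt h 0 r)
      by nra.
    destruct L as [L| ->]; [left; now apply exp_increasing|apply Rle_refl].
Qed.

Theorem corollary2p3 (psi : C -> C)
  (psi_univalent : univalent_disc psi)
  (psi_0 : psi (RtoC 0) = RtoC 0)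
  (psi_starlike : starlike_wrt (RtoC 0) (image_disc psi))
  (psi_max_mod : forall r : R, 0 < r < 1 ->
     is_circle_max (fun z => Cmod (psi z)) r (psi (RtoC r)))
  (psi_max_Re : forall r : R, 0 < r < 1 ->
     is_circle_max (fun z => Re (psi z)) r (psi (RtoC r)))
  (psi_min_Re : forall r : R, 0 < r < 1 ->
     is_circle_min (fun z => Re (psi z)) r (psi (RtoC (- r))))
  (f : C -> C) (f_F : class_F psi f)
  (r : R) (r_01 : 0 < r < 1) (z : C) (z_r : Cmod z = r) :
  Re (f z / z)%C <= M psi r /\
  Cmod (C_derive f z) <= (1 + Re (psi (RtoC r))) * M psi r /\
  curve_length f r <= 2 * PI * r * (1 + Re (psi (RtoC r))) * M psi r.
Proof.
  destruct f_F as ([f_an (a & a0 & a1 & f_series)] & f_nz &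
    (_ & _ & omega & om_an & om_disc & om_0 & om_eq)).
  assert (psi_an := proj1 psi_univalent).
  assert (Z0 : Cmod (RtoC 0) < 1) by (rewrite Cmod_0; lra).
  assert (D_of : forall F, analytic_disc F -> forall w, Cmod w < 1 ->
    exists l, cdiff F w l).
  { intros F HF w Hw. eexists. now apply cdiff_disc. }
  assert (psi_bound : forall w t, 0 < t < 1 -> Cmod w <= t ->
    Cmod (psi (omega w)) <= Re (psi (RtoC t))).
  { intros w t Ht Hw. apply majorant_on_circles; try assumption.
    apply Rle_trans with (Cmod w); [|exact Hw].
    apply schwarz; try assumption; [now apply D_of|lra]. }
  assert (f_0 : f (RtoC 0) = RtoC 0).
  { transitivity (a 0%nat); [|exact a0].
    apply (filterlim_locally_unique (V := C_NormedModule) _ _ _ (f_series _ Z0)).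
    apply (is_pseries_0 (K := C_AbsRing) (V := C_NormedModule) a). }
  destruct (quotient_by_z f (C_derive f (RtoC 0)) (D_of f f_an) f_0
    (cdiff_disc f _ f_an Z0)) as (k & k_0 & k_nz & kC & kD).
  assert (k_1 : k (RtoC 0) = RtoC 1).
  { rewrite k_0, <- a1. apply (power_series_derivative_at_0 a f);
      [exact f_series|now apply cdiff_disc]. }
  destruct (quotient_by_z psi (C_derive psi (RtoC 0)) (D_of psi psi_an) psi_0
    (cdiff_disc psi _ psi_an Z0)) as (g & _ & g_nz & gC & _).
  (* psi(z)/z extends continuously by g, which makes the integrand of M
     continuous up to the endpoint 0. *)
  assert (M_eq : M psi r = exp (RInt (fun t => Re (g (RtoC t))) 0 r)).
  { unfold M. f_equal. apply RInt_ext.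
    rewrite Rmin_left, Rmax_right by lra. intros t Ht.
    assert (tz : RtoC t <> RtoC 0) by (intro E; apply RtoC_inj in E; lra).
    rewrite g_nz by exact tz.
    destruct (psi (RtoC t)). simpl. field. lra. }
  assert (growth : forall w, Cmod w = r -> Cmod (k w) <= M psi r).
  { intros w Hw.
    assert (rz : RtoC r <> RtoC 0) by (intro E; apply RtoC_inj in E; lra).
    set (e := (w / r)%C).
    assert (He : Cmod e = 1).
    { unfold e. rewrite Cmod_div, Cmod_R, Rabs_pos_eq, Hw by (assumption || lra).
      field. lra. }
    assert (we : w = ray e r) by (rewrite ray_eq; unfold e; field; exact rz).
    rewrite we, M_eq.
    rewrite <- (Rmult_1_l (exp _)), <- Cmod_1, <- k_1.
    apply growth_along_ray; try assumption.
    - intros y Hy. destruct (Ceq_dec y (RtoC 0)) as [->|ny].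
      + rewrite k_1. intro E. apply RtoC_inj in E. lra.
      + rewrite k_nz by exact ny. intro E. apply (f_nz y Hy ny).
        replace (f y) with (f y / y * y)%C by (field; exact ny). rewrite E. ring.
    - intros t Ht. apply (continuous_along_curve Re g RtoC).
      + apply Re_lipschitz.
      + apply continuous_RtoC.
      + apply gC. rewrite Cmod_R. now apply Rabs_lt_between.
    - intros t Ht.
      assert (Ct : Cmod (ray e t) = t)
        by (rewrite Cmod_ray, He, Rabs_pos_eq; lra).
      assert (yd : Cmod (ray e t) < 1) by lra.
      assert (ny : ray e t <> RtoC 0) by (apply Cmod_gt_0; lra).
      assert (fy := f_nz _ yd ny).
      assert (tz : RtoC t <> RtoC 0) by (intro E; apply RtoC_inj in E; lra).
      eexists. split; [apply kD; [exact ny|now apply cdiff_disc]|].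
      assert (E := om_eq _ yd). unfold log_derivative in E.
      destruct Ceq_dec as [|_]; [contradiction|].
      assert (B := psi_bound (ray e t) t Ht (Req_le _ _ Ct)).
      rewrite <- E in B.
      rewrite k_nz by exact ny.
      assert (ez : e <> RtoC 0).
      { intro Ee. rewrite Ee, Cmod_0 in He. lra. }
      (* e k'/k = (z f'/f - 1) / t at z = t e, with k = f/z. *)
      replace ((C_derive f (ray e t) / ray e t -
          f (ray e t) / (ray e t * ray e t)) * e / (f (ray e t) / ray e t))%C
        with (RtoC (/ t) * (ray e t * C_derive f (ray e t) / f (ray e t) - 1))%C.
      2:{ rewrite RtoC_inv by lra. set (d := C_derive f (ray e t)).
          set (v := f (ray e t)) in *.
          rewrite !ray_eq. field. repeat split; assumption. }
      rewrite g_nz by exact tz.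
      assert (B' := Rle_trans _ _ _ (Rle_trans _ _ _ (Rle_abs _) (re_le_Cmod _)) B).
      set (x := (ray e t * _ / _ - 1)%C) in *.
      replace (Re (RtoC (/ t) * x)%C) with (/ t * Re x)
        by (destruct x; simpl; ring).
      replace (Re (psi (RtoC t) / RtoC t)%C) with (/ t * Re (psi (RtoC t)))
        by (destruct (psi (RtoC t)); simpl; field; lra).
      apply Rmult_le_compat_l; [left; apply Rinv_0_lt_compat; lra|exact B']. }
  (* f' is thereby a continuous function on the circle, hence the integrand of
     the length is integrable. *)
  assert (f'_eq : forall w, Cmod w = r ->
    C_derive f w = (k w * (1 + psi (omega w)))%C).
  { intros w Hw. assert (nw : w <> RtoC 0) by (apply Cmod_gt_0; lra).
    assert (wd : Cmod w < 1) by lra.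
    rewrite <- (om_eq w wd). unfold log_derivative.
    destruct Ceq_dec as [|_]; [contradiction|]. rewrite k_nz by exact nw.
    field. split; [now apply f_nz|exact nw]. }
  assert (distortion : forall w, Cmod w = r ->
    Cmod (C_derive f w) <= (1 + Re (psi (RtoC r))) * M psi r).
  { intros w Hw. rewrite f'_eq, Cmod_mult, Rmult_comm by exact Hw.
    apply Rmult_le_compat; try apply Cmod_ge_0; [|now apply growth].
    eapply Rle_trans; [apply Cmod_triangle|]. rewrite Cmod_1.
    apply Rplus_le_compat_l, psi_bound; lra. }
  assert (nz : z <> RtoC 0) by (apply Cmod_gt_0; lra).
  split; [|split; [now apply distortion|]].
  - rewrite <- k_nz by exact nz.
    eapply Rle_trans; [apply Rle_abs|].
    eapply Rle_trans; [apply re_le_Cmod|now apply growth].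
  - assert (on_circle : forall t, Cmod (polar r t) = r)
      by (intros t; rewrite Cmod_polar; apply Rabs_pos_eq; lra).
    assert (PI_pos := PI_RGT_0).
    unfold curve_length.
    change (RInt (fun t => Cmod (polar r t * C_derive f (polar r t))) 0 (2 * PI) <=
      2 * PI * r * (1 + Re (psi (RtoC r))) * M psi r).
    rewrite (RInt_ext _ (fun t =>
      Cmod (polar r t * (k (polar r t) * (1 + psi (omega (polar r t))))))).
    2:{ intros t _. now rewrite f'_eq. }
    eapply Rle_trans; [apply Rle_abs|].
    replace (2 * PI * r * (1 + Re (psi (RtoC r))) * M psi r) with
      ((2 * PI - 0) * (r * ((1 + Re (psi (RtoC r))) * M psi r))) by ring.
    apply abs_RInt_le_const; [lra| |].
    + apply (ex_RInt_continuous (V := R_CompleteNormedModule)). intros t _.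
      apply (continuous_along_curve Cmod
        (fun w => w * (k w * (1 + psi (omega w))))%C (polar r)).
      * apply Cmod_lipschitz.
      * apply continuous_polar.
      * assert (wd : Cmod (polar r t) < 1) by (rewrite on_circle; lra).
        apply C_continuous_mult; [apply C_continuous_id|].
        apply C_continuous_mult; [now apply kC|].
        apply C_continuous_plus; [apply C_continuous_const|].
        destruct (D_of omega om_an _ wd) as [l Hl].
        destruct (D_of psi psi_an _ (om_disc _ wd)) as [l' Hl'].
        apply (C_continuous_comp psi omega);
          eapply cdiff_continuous; eassumption.
    + intros t _. rewrite Rabs_pos_eq by apply Cmod_ge_0.
      rewrite Cmod_mult, on_circle, <- f'_eq by apply on_circle.
      apply Rmult_le_compat_l; [lra|]. now apply distortion.
Qed.
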